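(* Let $\alpha\in[0,1)$ and let $f=h+\overline{g}\in\check{L}_H^{\alpha}$. Then for all $z\in\Delta$, $$|f(z)|\geq \frac{(1-\alpha)|z|(1-|z|)}{(1+\alpha|z|)(1+|z|)^2}$$ and $$|f(z)|\leq \left(\frac{1-\alpha}{1+\alpha}\right)^2\log{\frac{1+\alpha |z|}{1-|z|}}+\frac{2|z|}{(1-|z|)^2}-\left(\frac{1-\alpha}{1+\alpha}\right)\frac{2|z|}{1-|z|}\leq \frac{(1+\alpha)|z|(1+|z|)}{(1+\alpha |z|)(1-|z|)^2}.$$
   Context: $\Delta$ is the open unit disc in $\mathbb{C}$. Every complex-valued harmonic function $f$ in $\Delta$ is uniquely represented as $f=h+\overline{g}$ with $h,g$ analytic in $\Delta$ and $g(0)=0$; write $h(z)=\sum_{n=0}^\infty a_nz^n$, $g(z)=\sum_{n=1}^\infty b_nz^n$. The Jacobian of $f$ is $J_f(z)=|h'(z)|^2-|g'(z)|^2$; $f$ is locally one-to-one and sense-preserving in $\Delta$ if and only if $J_f(z)>0$ for all $z\in\Delta$. $L_H$ denotes the set of all locally one-to-one and sense-preserving harmonic functions $f=h+\overline{g}$ in $\Delta$ with $h(0)=0$, $h'(0)=1$ (and $g(0)=0$). A starlike analytic function is a one-to-one analytic function in $\Delta$ fixing $0$ whose image is starlike with respect to the origin. For $\alpha\in[0,1)$, $\check{L}_H^{\alpha}$ is the class of all $f=h+\overline{g}\in L_H$ such that $|b_1|=|g'(0)|=\alpha$ and $h$ is a starlike analytic function. $\log$ is the natural logarithm. *)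

(* Defs.v *)
From Stdlib Require Import Reals.
From Coquelicot Require Import Coquelicot.

Open Scope R_scope.

(* Functions on the disc are modelled by total functions [C -> C]; only their
   values on the disc matter, since the disc is open. *)
Definition unit_disc (z : C) : Prop := Cmod z < 1.

Definition analytic_on_disc (h : C -> C) : Prop :=
  forall z : C, unit_disc z -> ex_derive (K := C_AbsRing) (V := C_NormedModule) h z.

Definition one_to_one_on_disc (h : C -> C) : Prop :=
  forall z w : C, unit_disc z -> unit_disc w -> h z = h w -> z = w.

Definition locally_one_to_one_on_disc (f : C -> C) : Prop :=
  forall z0 : C, unit_disc z0 ->
    exists r : R, 0 < r /\
      forall z w : C, unit_disc z -> unit_disc w ->
        Cmod (z - z0)%C < r -> Cmod (w - z0)%C < r -> f z = f w -> z = w.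

Definition starlike_wrt_0 (A : C -> Prop) : Prop :=
  forall (w : C) (t : R), A w -> 0 <= t <= 1 -> A (RtoC t * w)%C.

Definition image_of_disc (h : C -> C) (w : C) : Prop :=
  exists z : C, unit_disc z /\ h z = w.

Definition starlike_analytic (h : C -> C) : Prop :=
  analytic_on_disc h /\ one_to_one_on_disc h /\ h (RtoC 0) = RtoC 0 /\
  starlike_wrt_0 (image_of_disc h).

(* [f] is the complex-valued harmonic function on the disc whose canonical
   representation is [h + conj g].  On the disc this form characterizes
   harmonicity, and [h], [g] are determined by [f] there. *)
Definition harmonic_with_parts (f h g : C -> C) : Prop :=
  analytic_on_disc h /\ analytic_on_disc g /\ g (RtoC 0) = RtoC 0 /\
  forall z : C, unit_disc z -> f z = (h z + Cconj (g z))%C.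

(* The Jacobian determinant of [h + conj g] at [z]. *)
Definition jacobian (h g : C -> C) (z : C) : R :=
  (Cmod (C_derive h z)) ^ 2 - (Cmod (C_derive g z)) ^ 2.

Definition sense_preserving (h g : C -> C) : Prop :=
  forall z : C, unit_disc z -> 0 < jacobian h g z.

Definition L_H (f h g : C -> C) : Prop :=
  harmonic_with_parts f h g /\
  locally_one_to_one_on_disc f /\ sense_preserving h g /\
  h (RtoC 0) = RtoC 0 /\ C_derive h (RtoC 0) = RtoC 1.

Definition L_H_starlike (alpha : R) (f h g : C -> C) : Prop :=
  L_H f h g /\ Cmod (C_derive g (RtoC 0)) = alpha /\ starlike_analytic h.

(* Main.v *)
(* For t in [0,1] the map z |-> h^-1 (t h(z)) is a self-map of the disc fixing 0, so
   Schwarz's lemma gives |h^-1 (t h(z))| <= |z|; the derivative at t = 1 shows that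
   q = h/h' satisfies Re (q/z) >= 0.  Schwarz's lemma for (z - q)/(z + q) then confines
   z h'/h to a disc, which integrates radially to r/(1+r)^2 <= |h| <= r/(1-r)^2 and
   |h'| <= (1+r)/(1-r)^3.  Schwarz-Pick applied to g'/h' gives
   |g'| <= |h'| (a+r)/(1+ar), and integrating g along the h-preimage of [0, h(z)], which
   stays in the disc of radius |z|, also |g| <= |h| (a+r)/(1+ar).  The lower bound is
   |h| - |g|; the upper bound integrates |h'| + |g'| along a radius.
   Schwarz's lemma needs holomorphic functions to be twice differentiable; this comes from
   Goursat's theorem on rectangles and Cauchy's formula on a square. *)

Require Import Defs.
From Stdlib Require Import Reals Lra Lia Classical ClassicalEpsilon.
From Coquelicot Require Import Coquelicot.

Open Scope R_scope.

(** * Complex differentiability *)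

(** The quotient q = h/h' is preferred to z h'/h because it is analytic on the whole disc, 0
    included: the positive Jacobian makes h' nonvanishing. Functions such as (z - q)/(z + q) still
    have a removable singularity at 0, so Schwarz's lemma is proved with a linear growth bound at 0
    in place of differentiability there. The maximum principle behind it compares a value with four
    neighbours, which takes a second-order Taylor expansion and nothing more; hence a single extra
    derivative has to be extracted from Cauchy's formula. That formula is used as a ratio f(w) = T
    f(w) / T 1(w), where T phi(w) integrates phi(z)/(z - w) over a square: it suffices that T 1 does
    not vanish near the centre, and 2 pi i is never computed. Estimates along segments and radii are
    monotonicity statements for real functions: a rotation v turns a modulus into a real part, and
    Re(v conj g) = Re(conj v g) makes both parts of the harmonic function real parts of analytic
    ones. *)

Definition ccont (f : C -> C) (z : C) : Prop :=
  forall eps, 0 < eps -> exists delta, 0 < delta /\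
    forall w, Cmod (w - z) < delta -> Cmod (f w - f z) < eps.

(** The increment form avoids a quotient, and the non-strict inequality lets [w = z] pass without a
    case distinction. *)
Definition cdiff (f : C -> C) (z l : C) : Prop :=
  forall eps, 0 < eps -> exists delta, 0 < delta /\
    forall w, Cmod (w - z) < delta ->
      Cmod (f w - f z - l * (w - z)) <= eps * Cmod (w - z).

Lemma Cmod_sym (a b : C) : Cmod (a - b) = Cmod (b - a).
Proof. rewrite <- Cmod_opp. f_equal. ring. Qed.

Lemma Cmod_sub_le (a b : C) : Cmod a - Cmod b <= Cmod (a - b).
Proof.
  generalize (Cmod_triangle (a - b) b).
  replace (a - b + b)%C with a by ring. lra.
Qed.

Lemma Cmod_triangle_sub (a b : C) : Cmod (a - b) <= Cmod a + Cmod b.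
Proof. generalize (Cmod_triangle a (- b)). rewrite Cmod_opp. auto. Qed.

Lemma Cmod_dist_triangle (a b c : C) : Cmod (a - c) <= Cmod (a - b) + Cmod (b - c).
Proof.
  generalize (Cmod_triangle (a - b) (b - c)).
  replace (a - b + (b - c))%C with (a - c)%C by ring. auto.
Qed.

Lemma Cmod_sub_diag (a : C) : Cmod (a - a) = 0.
Proof. replace (a - a)%C with (RtoC 0) by ring. apply Cmod_0. Qed.

Lemma Cmod_sub_pos (a b : C) : a <> b -> 0 < Cmod (a - b).
Proof. intros H. apply Cmod_gt_0. now apply Cminus_eq_contra. Qed.

Lemma Cmod_sqr (z : C) : Cmod z ^ 2 = Re z ^ 2 + Im z ^ 2.
Proof. apply Cmod2_alt. Qed.

Lemma Im_le_Cmod (z : C) : Rabs (Im z) <= Cmod z.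
Proof. eapply Rle_trans; [apply Rmax_r | apply (Rmax_Cmod z)]. Qed.

Lemma Re_le_Cmod (z : C) : Re z <= Cmod z.
Proof. eapply Rle_trans; [apply Rle_abs | apply re_le_Cmod]. Qed.

Lemma Cmod_le_Re_Im (z : C) : Cmod z <= Rabs (Re z) + Rabs (Im z).
Proof.
  apply Rsqr_incr_0_var.
  - rewrite !Rsqr_pow2, Cmod_sqr, <- (pow2_abs (Re z)), <- (pow2_abs (Im z)).
    generalize (Rabs_pos (Re z)) (Rabs_pos (Im z)). nra.
  - generalize (Rabs_pos (Re z)) (Rabs_pos (Im z)). lra.
Qed.

(** Lets a modulus be estimated as the real part of [v * D] with [v] fixed, which reduces complex
    inequalities to real ones. *)
Lemma unit_rotation (D : C) : exists v, Cmod v = 1 /\ (v * D)%C = RtoC (Cmod D).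
Proof.
  destruct (Ceq_dec D 0) as [->|n].
  - exists (RtoC 1). split; [apply Cmod_1|]. rewrite Cmod_0. ring.
  - assert (P : 0 < Cmod D) by now apply Cmod_gt_0.
    assert (N : RtoC (Cmod D) <> RtoC 0) by (intros K; apply RtoC_inj in K; lra).
    exists (Cconj D / RtoC (Cmod D))%C. split.
    + rewrite Cmod_div by auto. rewrite Cmod_conj, Cmod_R, Rabs_right by lra. field. lra.
    + assert (K := Cmod2_conj D).
      replace (Cconj D / RtoC (Cmod D) * D)%C with (D * Cconj D / RtoC (Cmod D))%C
        by (field; auto).
      rewrite <- K. simpl. rewrite Rmult_1_r, RtoC_mult. field; auto.
Qed.

Lemma ccont_const (c z : C) : ccont (fun _ => c) z.
Proof.
  intros e He. exists 1; split; [lra|]. intros w _. now rewrite Cmod_sub_diag.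
Qed.

Lemma ccont_id (z : C) : ccont (fun w => w) z.
Proof. intros e He. exists e; split; auto. Qed.

Lemma ccont_plus (f g : C -> C) (z : C) :
  ccont f z -> ccont g z -> ccont (fun w => (f w + g w)%C) z.
Proof.
  intros Hf Hg e He.
  destruct (Hf (e/2)) as [d1 [Hd1 H1]]; [lra|].
  destruct (Hg (e/2)) as [d2 [Hd2 H2]]; [lra|].
  exists (Rmin d1 d2); split; [now apply Rmin_glb_lt|].
  intros w Hw.
  specialize (H1 w (Rlt_le_trans _ _ _ Hw (Rmin_l _ _))).
  specialize (H2 w (Rlt_le_trans _ _ _ Hw (Rmin_r _ _))).
  replace (f w + g w - (f z + g z))%C with ((f w - f z) + (g w - g z))%C by ring.
  generalize (Cmod_triangle (f w - f z) (g w - g z)). lra.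
Qed.

Lemma ccont_mult (f g : C -> C) (z : C) :
  ccont f z -> ccont g z -> ccont (fun w => (f w * g w)%C) z.
Proof.
  intros Hf Hg e He.
  set (B := Cmod (f z) + Cmod (g z) + 1).
  assert (HB : 1 <= B) by (generalize (Cmod_ge_0 (f z)) (Cmod_ge_0 (g z)); unfold B; lra).
  set (e' := Rmin 1 (e / (2 * B))).
  assert (He' : 0 < e') by (apply Rmin_glb_lt; [lra|apply Rdiv_lt_0_compat; lra]).
  destruct (Hf e') as [d1 [Hd1 H1]]; [lra|].
  destruct (Hg e') as [d2 [Hd2 H2]]; [lra|].
  exists (Rmin d1 d2); split; [now apply Rmin_glb_lt|].
  intros w Hw.
  specialize (H1 w (Rlt_le_trans _ _ _ Hw (Rmin_l _ _))).
  specialize (H2 w (Rlt_le_trans _ _ _ Hw (Rmin_r _ _))).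
  replace (f w * g w - (f z * g z))%C
    with ((f w - f z) * ((g w - g z) + g z) + f z * (g w - g z))%C by ring.
  eapply Rle_lt_trans; [apply Cmod_triangle|]. rewrite !Cmod_mult.
  assert (H3 := Cmod_triangle (g w - g z) (g z)).
  assert (E1 : e' <= 1) by apply Rmin_l.
  assert (E2 : e' * (2 * B) <= e).
  { assert (e' <= e / (2 * B)) by apply Rmin_r.
    apply (Rmult_le_compat_r (2 * B)) in H; [|lra].
    replace (e / (2 * B) * (2 * B)) with e in H by (field; lra). exact H. }
  assert (P1 := Cmod_ge_0 (f w - f z)). assert (P2 := Cmod_ge_0 (g w - g z)).
  assert (P3 := Cmod_ge_0 (f z)). assert (P4 := Cmod_ge_0 (g z)).
  assert (P5 := Cmod_ge_0 (g w - g z + g z)).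
  assert (A1 : Cmod (f w - f z) * Cmod (g w - g z + g z) <= e' * (1 + Cmod (g z))).
  { apply Rmult_le_compat; lra. }
  assert (A2 : Cmod (f z) * Cmod (g w - g z) <= Cmod (f z) * e').
  { apply Rmult_le_compat_l; lra. }
  assert (e' * B = e' * (1 + Cmod (g z)) + Cmod (f z) * e') by (unfold B; ring).
  nra.
Qed.

Lemma ccont_opp (f : C -> C) (z : C) : ccont f z -> ccont (fun w => (- f w)%C) z.
Proof.
  intros Hf e He. destruct (Hf e He) as [d [Hd H]]. exists d; split; auto.
  intros w Hw. replace (- f w - - f z)%C with (- (f w - f z))%C by ring.
  rewrite Cmod_opp. auto.
Qed.

Lemma ccont_comp (f g : C -> C) (z : C) :
  ccont g z -> ccont f (g z) -> ccont (fun w => f (g w)) z.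
Proof.
  intros Hg Hf e He. destruct (Hf e He) as [d [Hd H]].
  destruct (Hg d Hd) as [d' [Hd' H']]. exists d'; split; auto.
Qed.

Lemma ccont_ext_loc (f g : C -> C) (z : C) (r : R) :
  0 < r -> (forall w, Cmod (w - z) < r -> f w = g w) -> ccont f z -> ccont g z.
Proof.
  intros Hr E Hf e He. destruct (Hf e He) as [d [Hd H]].
  exists (Rmin r d); split; [now apply Rmin_glb_lt|].
  intros w Hw. rewrite <- (E w), <- (E z).
  - apply H. eapply Rlt_le_trans; [exact Hw|apply Rmin_r].
  - now rewrite Cmod_sub_diag.
  - eapply Rlt_le_trans; [exact Hw|apply Rmin_l].
Qed.

Lemma ccont_inv_id (z : C) : z <> RtoC 0 -> ccont Cinv z.
Proof.
  intros Hz e He. assert (Pz : 0 < Cmod z) by now apply Cmod_gt_0.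
  set (d := Rmin (Cmod z / 2) (e * (Cmod z ^ 2) / 4)).
  exists d. split.
  { apply Rmin_glb_lt; [lra|]. apply Rdiv_lt_0_compat; [|lra].
    apply Rmult_lt_0_compat; auto. now apply pow_lt. }
  intros w Hw.
  assert (H1 : Cmod (w - z) < Cmod z / 2) by (eapply Rlt_le_trans; [exact Hw|apply Rmin_l]).
  assert (H2 : Cmod (w - z) < e * (Cmod z ^ 2) / 4) by (eapply Rlt_le_trans; [exact Hw|apply Rmin_r]).
  assert (H3 : Cmod z / 2 < Cmod w).
  { generalize (Cmod_sub_le z w). rewrite (Cmod_sym z w). lra. }
  assert (Hw0 : w <> RtoC 0) by (apply Cmod_gt_0; lra).
  replace (/ w - / z)%C with ((z - w) / (w * z))%C by (field; auto).
  rewrite Cmod_div by now apply Cmult_neq_0.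
  rewrite Cmod_sym, Cmod_mult.
  assert (P : 0 < Cmod w * Cmod z) by (apply Rmult_lt_0_compat; lra).
  apply (Rmult_lt_reg_r (Cmod w * Cmod z)); auto.
  unfold Rdiv. rewrite Rmult_assoc, Rinv_l, Rmult_1_r by lra.
  assert (0 < e * Cmod z * (Cmod w - Cmod z / 2)).
  { repeat apply Rmult_lt_0_compat; lra. }
  nra.
Qed.

Lemma ccont_inv (f : C -> C) (z : C) :
  f z <> RtoC 0 -> ccont f z -> ccont (fun w => (/ f w)%C) z.
Proof. intros H0 Hf. apply (ccont_comp Cinv f); auto. now apply ccont_inv_id. Qed.

(* Caratheodory's criterion, which makes the product and chain rules algebraic. *)
Lemma cdiff_slope (f : C -> C) (z l : C) :
  cdiff f z l <->
  exists q, ccont q z /\ q z = l /\ forall w, (f w = f z + q w * (w - z))%C.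
Proof.
  split.
  - intros H.
    exists (fun w => if Ceq_dec w z then l else ((f w - f z) / (w - z))%C).
    destruct (Ceq_dec z z) as [_|n]; [|now elim n].
    split; [|split; auto].
    + intros e He. destruct (H (e/2)) as [d [Hd H1]]; [lra|].
      exists d; split; auto. intros w Hw.
      destruct (Ceq_dec z z) as [_|n]; [|now elim n].
      destruct (Ceq_dec w z) as [->|n]; [now rewrite Cmod_sub_diag|].
      specialize (H1 w Hw).
      assert (P := Cmod_sub_pos _ _ n). assert (Q := Cminus_eq_contra _ _ n).
      replace ((f w - f z) / (w - z) - l)%C
        with ((f w - f z - l * (w - z)) / (w - z))%C by (field; auto).
      rewrite Cmod_div by auto.
      apply (Rmult_lt_reg_r (Cmod (w - z))); auto.
      unfold Rdiv. rewrite Rmult_assoc, Rinv_l, Rmult_1_r by lra. nra.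
    + intros w. destruct (Ceq_dec w z) as [->|n]; [ring|].
      field. now apply Cminus_eq_contra.
  - intros [q [Hq [Hl E]]] e He.
    destruct (Hq e He) as [d [Hd H]]. exists d; split; auto.
    intros w Hw. rewrite (E w), <- Hl.
    replace (f z + q w * (w - z) - f z - q z * (w - z))%C
      with ((q w - q z) * (w - z))%C by ring.
    rewrite Cmod_mult. apply Rmult_le_compat_r; [apply Cmod_ge_0|].
    left; auto.
Qed.

Lemma cdiff_ccont (f : C -> C) (z l : C) : cdiff f z l -> ccont f z.
Proof.
  intros H. apply cdiff_slope in H. destruct H as [q [Hq [_ E]]].
  apply (ccont_ext_loc (fun w => f z + q w * (w - z))%C _ z 1); [lra| |].
  - intros w _. now rewrite <- E.
  - apply ccont_plus; [apply ccont_const|]. apply ccont_mult; auto.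
    apply (ccont_plus (fun w => w) (fun _ => - z)%C); [apply ccont_id|apply ccont_const].
Qed.

Lemma cdiff_const (c z : C) : cdiff (fun _ => c) z 0.
Proof.
  apply cdiff_slope. exists (fun _ => RtoC 0).
  repeat split; [apply ccont_const|intros; ring].
Qed.

Lemma cdiff_id (z : C) : cdiff (fun w => w) z 1.
Proof.
  apply cdiff_slope. exists (fun _ => RtoC 1).
  repeat split; [apply ccont_const|intros; ring].
Qed.

Lemma cdiff_plus (f g : C -> C) (z l m : C) :
  cdiff f z l -> cdiff g z m -> cdiff (fun w => f w + g w)%C z (l + m).
Proof.
  rewrite !cdiff_slope. intros [q [Hq [<- E]]] [p [Hp [<- F]]].
  exists (fun w => q w + p w)%C. split; [now apply ccont_plus|]. split; auto.
  intros w. rewrite (E w), (F w). ring.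
Qed.

Lemma cdiff_mult (f g : C -> C) (z l m : C) :
  cdiff f z l -> cdiff g z m -> cdiff (fun w => f w * g w)%C z (l * g z + f z * m).
Proof.
  intros Hf Hg. assert (Cg := cdiff_ccont _ _ _ Hg). revert Hf Hg.
  rewrite !cdiff_slope. intros [q [Hq [<- E]]] [p [Hp [<- F]]].
  exists (fun w => q w * g w + f z * p w)%C. split; [|split; auto].
  - apply ccont_plus; apply ccont_mult; auto. apply ccont_const.
  - intros w. rewrite (E w), (F w). ring.
Qed.

Lemma cdiff_comp (f g : C -> C) (z l m : C) :
  cdiff g z m -> cdiff f (g z) l -> cdiff (fun w => f (g w)) z (l * m).
Proof.
  intros Hg Hf. assert (Cg := cdiff_ccont _ _ _ Hg). revert Hf Hg.
  rewrite !cdiff_slope. intros [q [Hq [<- E]]] [p [Hp [<- F]]].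
  exists (fun w => q (g w) * p w)%C. split; [|split; auto].
  - apply ccont_mult; auto. now apply (ccont_comp q g).
  - intros w. rewrite (E (g w)), (F w). ring.
Qed.

Lemma cdiff_ext_loc (f g : C -> C) (z l : C) (r : R) :
  0 < r -> (forall w, Cmod (w - z) < r -> f w = g w) -> cdiff f z l -> cdiff g z l.
Proof.
  intros Hr E Hf e He. destruct (Hf e He) as [d [Hd H]].
  exists (Rmin r d); split; [now apply Rmin_glb_lt|].
  intros w Hw. rewrite <- (E w), <- (E z).
  - apply H. eapply Rlt_le_trans; [exact Hw|apply Rmin_r].
  - now rewrite Cmod_sub_diag.
  - eapply Rlt_le_trans; [exact Hw|apply Rmin_l].
Qed.

Lemma cdiff_eq (f : C -> C) (z l m : C) : cdiff f z l -> l = m -> cdiff f z m.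
Proof. now intros H <-. Qed.

Lemma cdiff_opp (f : C -> C) (z l : C) :
  cdiff f z l -> cdiff (fun w => - f w)%C z (- l).
Proof.
  rewrite !cdiff_slope. intros [q [Hq [<- E]]].
  exists (fun w => - q w)%C. split; [now apply ccont_opp|]. split; auto.
  intros w. rewrite (E w). ring.
Qed.

Lemma cdiff_minus (f g : C -> C) (z l m : C) :
  cdiff f z l -> cdiff g z m -> cdiff (fun w => f w - g w)%C z (l - m).
Proof. intros Hf Hg. apply (cdiff_plus f (fun w => - g w)%C); auto. now apply cdiff_opp. Qed.

Lemma cdiff_scal (c : C) (f : C -> C) (z l : C) :
  cdiff f z l -> cdiff (fun w => c * f w)%C z (c * l).
Proof.
  intros H. eapply cdiff_eq; [apply (cdiff_mult (fun _ => c)); [apply cdiff_const|exact H]|].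
  simpl; ring.
Qed.

Lemma cdiff_inv_id (z : C) : z <> RtoC 0 -> cdiff Cinv z (- / (z * z)).
Proof.
  intros Hz. assert (Pz : 0 < Cmod z) by now apply Cmod_gt_0.
  (* Caratheodory's criterion asks for the identity at every [w], which fails for [Cinv] at [w = 0].
     The function is therefore changed at 0 only, outside the disc of radius [Cmod z] about [z]. *)
  apply (cdiff_ext_loc
    (fun w => / z + (if Ceq_dec w 0 then - / (z * z) else - / (w * z)) * (w - z))%C
    _ z _ (Cmod z)); auto.
  - intros w Hw. destruct (Ceq_dec w 0) as [->|n].
    + exfalso. revert Hw. rewrite Cmod_sym. replace (z - 0)%C with z by ring. lra.
    + field; auto.
  - apply cdiff_slope.
    exists (fun w => if Ceq_dec w 0 then - / (z * z) else - / (w * z))%C.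
    destruct (Ceq_dec z 0) as [n|_]; [contradiction|].
    split; [|split; auto].
    + apply (ccont_ext_loc (fun w => - / (w * z))%C _ z (Cmod z)); auto.
      * intros w Hw. destruct (Ceq_dec w 0) as [->|n]; auto.
        exfalso. revert Hw. rewrite Cmod_sym. replace (z - 0)%C with z by ring. lra.
      * apply ccont_opp. apply ccont_inv; [now apply Cmult_neq_0|].
        apply ccont_mult; [apply ccont_id|apply ccont_const].
    + intros w. ring.
Qed.

Lemma cdiff_inv (f : C -> C) (z l : C) :
  f z <> RtoC 0 -> cdiff f z l -> cdiff (fun w => / f w)%C z (- l / (f z * f z)).
Proof.
  intros H0 Hf. eapply cdiff_eq.
  - apply (cdiff_comp Cinv f); [exact Hf|now apply cdiff_inv_id].
  - simpl. field. auto.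
Qed.

Lemma cdiff_div (f g : C -> C) (z l m : C) :
  g z <> RtoC 0 -> cdiff f z l -> cdiff g z m ->
  cdiff (fun w => f w / g w)%C z ((l * g z - f z * m) / (g z * g z)).
Proof.
  intros H0 Hf Hg. eapply cdiff_eq.
  - apply (cdiff_mult f (fun w => / g w)%C); [exact Hf|now apply cdiff_inv; [|exact Hg]].
  - simpl. field. auto.
Qed.

Lemma cdiff_pow (f : C -> C) (n : nat) (z l : C) :
  cdiff f z l -> exists m, cdiff (fun w => f w ^ n)%C z m.
Proof.
  intros H. induction n as [|n [m IH]].
  - exists (RtoC 0). exact (cdiff_const (RtoC 1) z).
  - eexists. apply (cdiff_mult f (fun w => f w ^ n)%C); eassumption.
Qed.

Lemma cdiff_unique (f : C -> C) (z l m : C) : cdiff f z l -> cdiff f z m -> l = m.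
Proof.
  intros Hl Hm. apply Ceq_minus, Cmod_eq_0.
  apply Rle_antisym; [|apply Cmod_ge_0].
  apply Rnot_lt_le. intros P.
  destruct (Hl (Cmod (l - m) / 3)) as [d1 [Hd1 H1]]; [lra|].
  destruct (Hm (Cmod (l - m) / 3)) as [d2 [Hd2 H2]]; [lra|].
  set (d := Rmin d1 d2 / 2).
  assert (Hd : 0 < Rmin d1 d2) by now apply Rmin_glb_lt.
  assert (D1 := Rmin_l d1 d2). assert (D2 := Rmin_r d1 d2).
  assert (Hmod : Cmod (z + RtoC d - z) = d).
  { replace (z + RtoC d - z)%C with (RtoC d) by ring.
    rewrite Cmod_R. apply Rabs_right. unfold d; lra. }
  specialize (H1 (z + RtoC d)%C). specialize (H2 (z + RtoC d)%C).
  rewrite Hmod in H1, H2.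
  assert (K1 := H1 ltac:(unfold d; lra)). assert (K2 := H2 ltac:(unfold d; lra)).
  assert (K : Cmod ((l - m) * (z + RtoC d - z)) <= 2 * (Cmod (l - m) / 3) * d).
  { replace ((l - m) * (z + RtoC d - z))%C with
      ((f (z + RtoC d) - f z - m * (z + RtoC d - z))
       - (f (z + RtoC d) - f z - l * (z + RtoC d - z)))%C by ring.
    eapply Rle_trans; [apply Cmod_triangle_sub|]. lra. }
  rewrite Cmod_mult, Hmod in K.
  assert (0 < d) by (unfold d; lra). nra.
Qed.

Lemma is_derive_cdiff (f : C -> C) (z l : C) :
  is_derive (K := C_AbsRing) (V := C_NormedModule) f z l -> cdiff f z l.
Proof.
  intros [_ H] e He.
  specialize (H z (fun P HP => HP) (mkposreal e He)).
  destruct H as [d Hd]. exists d. split; [apply cond_pos|].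
  intros w Hw. specialize (Hd w Hw).
  change (Cmod (f w - f z - (w - z) * l) <= e * Cmod (w - z)) in Hd.
  now rewrite (Cmult_comm l).
Qed.

Lemma cdiff_is_derive_line (f : C -> C) (z e l : C) (t : R) :
  cdiff f (z + RtoC t * e) l ->
  is_derive (fun s => Re (f (z + RtoC s * e)%C)) t (Re (l * e)).
Proof.
  intros H. split; [apply is_linear_scal_l|].
  intros x Hx. apply (is_filter_lim_locally_unique t x) in Hx. subst x.
  (* The summand 1 keeps [B] positive when the direction [e] is zero. *)
  intros eps. set (B := Cmod e + 1).
  assert (HB : 0 < B) by (generalize (Cmod_ge_0 e); unfold B; lra).
  destruct (H (eps / B)) as [d [Hd H1]]; [apply Rdiv_lt_0_compat; auto; apply cond_pos|].
  assert (Hd' : 0 < d / B) by now apply Rdiv_lt_0_compat.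
  exists (mkposreal _ Hd'). intros s Hs.
  change (Rabs (s - t) < d / B) in Hs.
  change (Rabs (Re (f (z + RtoC s * e)%C) - Re (f (z + RtoC t * e)%C)
     - (s - t) * Re (l * e)) <= eps * Rabs (s - t)).
  assert (E : (z + RtoC s * e - (z + RtoC t * e) = RtoC (s - t) * e)%C).
  { rewrite RtoC_minus. ring. }
  specialize (H1 (z + RtoC s * e)%C). rewrite E, Cmod_mult, Cmod_R in H1.
  assert (P := Rabs_pos (s - t)). assert (Pe := Cmod_ge_0 e).
  assert (L : Rabs (s - t) * B < d).
  { apply (Rmult_lt_compat_r B) in Hs; auto.
    unfold Rdiv in Hs. rewrite Rmult_assoc, Rinv_l, Rmult_1_r in Hs; lra. }
  eapply Rle_trans; [|eapply Rle_trans; [apply H1; unfold B in L; nra|]].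
  - eapply Rle_trans; [|apply re_le_Cmod]. right. f_equal.
    unfold Re, Cminus, Cplus, Copp, Cmult, RtoC; simpl. ring.
  - assert (eps / B * B = eps) by (field; lra).
    assert (0 <= eps / B) by (apply Rlt_le, Rdiv_lt_0_compat; auto; apply cond_pos).
    unfold B in *. nra.
Qed.

Lemma choose_derivative (D : C -> Prop) (f : C -> C) :
  (forall z, D z -> exists l, cdiff f z l) -> exists f', forall z, D z -> cdiff f z (f' z).
Proof.
  intros H. exists (fun z => epsilon (inhabits (RtoC 0)) (fun l => cdiff f z l)).
  intros z Hz. apply (epsilon_spec (inhabits (RtoC 0)) (fun l => cdiff f z l)). auto.
Qed.

(** Takes the place of integration in the estimates along segments and radii: an inequality between
    derivatives is integrated by showing that a difference is monotone. *)
Lemma incr_of_derive (phi dphi : R -> R) (a b : R) : a <= b ->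
  (forall t, a <= t <= b -> is_derive phi t (dphi t) /\ 0 <= dphi t) -> phi a <= phi b.
Proof.
  intros Hab H. destruct (MVT_gen phi a b dphi) as [c [Hc E]].
  - intros x. rewrite Rmin_left, Rmax_right by auto. intros Hx. apply H. lra.
  - intros x. rewrite Rmin_left, Rmax_right by auto. intros Hx.
    apply derivable_continuous_pt. exists (dphi x). apply is_derive_Reals, H. lra.
  - rewrite Rmin_left, Rmax_right in Hc by auto.
    assert (0 <= dphi c * (b - a)) by (apply Rmult_le_pos; [apply H; lra|lra]). lra.
Qed.

(** Rotate the increment to a positive real number; then [M * Cmod e * t] minus the rotated real
    part is nondecreasing in [t]. *)
Lemma cdiff_segment_bound (f f' : C -> C) (z e : C) (M : R) :
  (forall t, 0 <= t <= 1 -> cdiff f (z + RtoC t * e) (f' (z + RtoC t * e)%C) /\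
     Cmod (f' (z + RtoC t * e)%C) <= M) ->
  Cmod (f (z + e)%C - f z) <= M * Cmod e.
Proof.
  intros H. destruct (unit_rotation (f (z + e)%C - f z)) as [v [Hv E]].
  apply (f_equal Re) in E. rewrite re_RtoC in E. rewrite <- E.
  assert (K := incr_of_derive
    (fun t => M * Cmod e * t - Re (v * f (z + RtoC t * e)%C)%C)
    (fun t => M * Cmod e * 1 - Re (v * f' (z + RtoC t * e)%C * e)%C) 0 1 Rle_0_1).
  lapply K; clear K; [intros K|].
  - rewrite Cmult_0_l, Cplus_0_r, Cmult_1_l in K.
    replace (Re (v * (f (z + e)%C - f z))%C)
      with (Re (v * f (z + e)%C)%C - Re (v * f z)%C) by (unfold Re; simpl; ring). lra.
  - intros t Ht. destruct (H t Ht) as [H1 H2]. split.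
    + apply (is_derive_minus (V := R_NormedModule)).
      * apply (is_derive_scal (fun t => t)). apply (is_derive_id (K := R_AbsRing)).
      * apply (cdiff_is_derive_line (fun w => v * f w)%C). now apply cdiff_scal.
    + eapply Rle_trans; [|apply Rplus_le_compat_l, Ropp_le_contravar, Re_le_Cmod].
      rewrite !Cmod_mult, Hv. generalize (Cmod_ge_0 e). nra.
Qed.

(** * Integrals over rectangles and Goursat's theorem *)

Definition rcont (f : R -> C) (t : R) : Prop :=
  continuous (fun s => Re (f s)) t /\ continuous (fun s => Im (f s)) t.

Definition cint (f : R -> C) (a b : R) : C :=
  (RInt (fun t => Re (f t)) a b, RInt (fun t => Im (f t)) a b).

Lemma rcont_intro (f : R -> C) (t : R) :
  (forall eps, 0 < eps -> exists delta, 0 < delta /\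
     forall s, Rabs (s - t) < delta -> Cmod (f s - f t) < eps) -> rcont f t.
Proof.
  intros H.
  split; apply filterlim_locally; intros eps;
    destruct (H eps (cond_pos eps)) as [d [Hd K]];
    exists (mkposreal d Hd); intros s Hs; specialize (K s Hs);
    eapply Rle_lt_trans; try exact K.
  - change (Rabs (Re (f s) - Re (f t)) <= Cmod (f s - f t)).
    replace (Re (f s) - Re (f t)) with (Re (f s - f t)%C); [apply re_le_Cmod|].
    unfold Re, Cminus, Cplus, Copp; simpl; ring.
  - change (Rabs (Im (f s) - Im (f t)) <= Cmod (f s - f t)).
    replace (Im (f s) - Im (f t)) with (Im (f s - f t)%C); [apply Im_le_Cmod|].
    unfold Im, Cminus, Cplus, Copp; simpl; ring.
Qed.

Lemma rcont_hor (f : C -> C) (x y : R) : ccont f (x, y) -> rcont (fun t => f (t, y)) x.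
Proof.
  intros H. apply rcont_intro. intros e He. destruct (H e He) as [d [Hd K]].
  exists d; split; auto. intros s Hs. apply K.
  replace ((s, y) - (x, y))%C with (RtoC (s - x)); [now rewrite Cmod_R|].
  apply injective_projections; simpl; ring.
Qed.

Lemma rcont_ver (f : C -> C) (x y : R) : ccont f (x, y) -> rcont (fun t => f (x, t)) y.
Proof.
  intros H. apply rcont_intro. intros e He. destruct (H e He) as [d [Hd K]].
  exists d; split; auto. intros s Hs. apply K.
  replace ((x, s) - (x, y))%C with (Ci * RtoC (s - y))%C.
  - now rewrite Cmod_mult, Cmod_Ci, Cmod_R, Rmult_1_l.
  - apply injective_projections; simpl; ring.
Qed.

Definition rcont_on (f : R -> C) (a b : R) : Prop := forall t, a <= t <= b -> rcont f t.

Lemma rcont_on_ex (f : R -> C) (a b : R) : a <= b -> rcont_on f a b ->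
  ex_RInt (fun t => Re (f t)) a b /\ ex_RInt (fun t => Im (f t)) a b.
Proof.
  intros Hab H. split; apply (ex_RInt_continuous (V := R_CompleteNormedModule));
    intros z; rewrite Rmin_left, Rmax_right by auto; intros Hz; apply (H z Hz).
Qed.

Lemma cint_Chasles (f : R -> C) (a m b : R) : a <= m <= b -> rcont_on f a b ->
  cint f a b = (cint f a m + cint f m b)%C.
Proof.
  intros Hm H.
  destruct (rcont_on_ex f a m) as [A1 A2]; [lra|intros t Ht; apply H; lra|].
  destruct (rcont_on_ex f m b) as [B1 B2]; [lra|intros t Ht; apply H; lra|].
  apply injective_projections; simpl; symmetry;
    now apply (RInt_Chasles (V := R_CompleteNormedModule)).
Qed.

Lemma cint_ext (f g : R -> C) (a b : R) : a <= b -> (forall t, a <= t <= b -> f t = g t) ->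
  cint f a b = cint g a b.
Proof.
  intros Hab H. apply injective_projections; simpl;
    apply (RInt_ext (V := R_CompleteNormedModule)); intros t;
    rewrite Rmin_left, Rmax_right by auto; intros Ht; rewrite H; auto; lra.
Qed.

Lemma cint_plus (f g : R -> C) (a b : R) : a <= b -> rcont_on f a b -> rcont_on g a b ->
  cint (fun t => f t + g t)%C a b = (cint f a b + cint g a b)%C.
Proof.
  intros Hab Hf Hg.
  destruct (rcont_on_ex f a b Hab Hf) as [A1 A2].
  destruct (rcont_on_ex g a b Hab Hg) as [B1 B2].
  apply injective_projections; simpl;
    now apply (RInt_plus (V := R_CompleteNormedModule)).
Qed.

Lemma cint_scal (c : C) (f : R -> C) (a b : R) : a <= b -> rcont_on f a b ->
  cint (fun t => c * f t)%C a b = (c * cint f a b)%C.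
Proof.
  intros Hab Hf. destruct (rcont_on_ex f a b Hab Hf) as [A1 A2].
  apply injective_projections; simpl.
  - rewrite <- !(RInt_scal (V := R_CompleteNormedModule)) by auto.
    rewrite <- (RInt_minus (V := R_CompleteNormedModule))
      by (apply (ex_RInt_scal (V := R_CompleteNormedModule)); auto).
    reflexivity.
  - rewrite <- !(RInt_scal (V := R_CompleteNormedModule)) by auto.
    rewrite <- (RInt_plus (V := R_CompleteNormedModule))
      by (apply (ex_RInt_scal (V := R_CompleteNormedModule)); auto).
    reflexivity.
Qed.

Lemma cint_const (c : C) (a b : R) : cint (fun _ => c) a b = (RtoC (b - a) * c)%C.
Proof.
  apply injective_projections; simpl; rewrite (RInt_const (V := R_CompleteNormedModule));
    change (@scal R_AbsRing R_NormedModule) with Rmult; simpl;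
    unfold scal; simpl; unfold mult; simpl; unfold Re, Im; ring.
Qed.

Lemma rcont_scal (c : C) (f : R -> C) (t : R) : rcont f t -> rcont (fun s => c * f s)%C t.
Proof.
  intros [H1 H2]. split; simpl.
  - apply (continuous_minus (V := R_NormedModule));
      apply (continuous_mult (K := R_AbsRing)); auto; apply continuous_const.
  - apply (continuous_plus (V := R_NormedModule));
      apply (continuous_mult (K := R_AbsRing)); auto; apply continuous_const.
Qed.

(** Rotating the integral to a real number leaves one real integrand bounded by [M]; estimating the
    two components separately would lose a factor. *)
Lemma cint_bound (f : R -> C) (a b M : R) : a <= b -> rcont_on f a b ->
  (forall t, a <= t <= b -> Cmod (f t) <= M) -> Cmod (cint f a b) <= (b - a) * M.
Proof.
  intros Hab Hf HM. destruct (unit_rotation (cint f a b)) as [v [Hv E]].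
  rewrite <- cint_scal in E by auto. apply (f_equal Re) in E. simpl in E. rewrite <- E.
  destruct (rcont_on_ex (fun t => v * f t)%C a b Hab) as [X _].
  { intros t Ht. apply rcont_scal. auto. }
  rewrite <- (Rmult_comm M).
  replace (M * (b - a)) with (RInt (fun _ => M) a b)
    by (rewrite (RInt_const (V := R_CompleteNormedModule)); unfold scal; simpl;
        unfold mult; simpl; ring).
  apply RInt_le; auto.
  - apply (ex_RInt_const (V := R_NormedModule)).
  - intros t Ht. change (Re (v * f t)%C <= M).
    eapply Rle_trans; [apply Re_le_Cmod|]. rewrite Cmod_mult, Hv, Rmult_1_l.
    apply HM; lra.
Qed.

(* The integral of [f dz] along the positively oriented boundary of [a,b] x [c,d]. *)
Definition rect (f : C -> C) (a b c d : R) : C :=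
  (cint (fun x => f (x, c)) a b - cint (fun x => f (x, d)) a b
   + Ci * (cint (fun y => f (b, y)) c d - cint (fun y => f (a, y)) c d))%C.

Definition cont_bd (f : C -> C) (a b c d : R) : Prop :=
  (forall x, a <= x <= b -> ccont f (x, c) /\ ccont f (x, d)) /\
  (forall y, c <= y <= d -> ccont f (a, y) /\ ccont f (b, y)).

Lemma cont_bd_rcont (f : C -> C) (a b c d : R) : cont_bd f a b c d ->
  rcont_on (fun x => f (x, c)) a b /\ rcont_on (fun x => f (x, d)) a b /\
  rcont_on (fun y => f (a, y)) c d /\ rcont_on (fun y => f (b, y)) c d.
Proof.
  intros [H K]. split; [|split; [|split]]; intros t Ht.
  - apply (rcont_hor f), (proj1 (H t Ht)).
  - apply (rcont_hor f), (proj2 (H t Ht)).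
  - apply (rcont_ver f), (proj1 (K t Ht)).
  - apply (rcont_ver f), (proj2 (K t Ht)).
Qed.

Lemma rect_split_x (f : C -> C) (a m b c d : R) : a <= m <= b -> cont_bd f a b c d ->
  rect f a b c d = (rect f a m c d + rect f m b c d)%C.
Proof.
  intros Hm H. destruct (cont_bd_rcont _ _ _ _ _ H) as [A [B _]].
  unfold rect. rewrite (cint_Chasles _ a m b Hm A), (cint_Chasles _ a m b Hm B). ring.
Qed.

Lemma rect_split_y (f : C -> C) (a b c m d : R) : c <= m <= d -> cont_bd f a b c d ->
  rect f a b c d = (rect f a b c m + rect f a b m d)%C.
Proof.
  intros Hm H. destruct (cont_bd_rcont _ _ _ _ _ H) as [_ [_ [A B]]].
  unfold rect. rewrite (cint_Chasles _ c m d Hm A), (cint_Chasles _ c m d Hm B). ring.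
Qed.

Lemma rect_plus (f g : C -> C) (a b c d : R) : a <= b -> c <= d ->
  cont_bd f a b c d -> cont_bd g a b c d ->
  rect (fun z => f z + g z)%C a b c d = (rect f a b c d + rect g a b c d)%C.
Proof.
  intros Hab Hcd Hf Hg.
  destruct (cont_bd_rcont _ _ _ _ _ Hf) as [A1 [A2 [A3 A4]]].
  destruct (cont_bd_rcont _ _ _ _ _ Hg) as [B1 [B2 [B3 B4]]].
  unfold rect. rewrite !cint_plus by assumption. ring.
Qed.

Lemma rect_scal (k : C) (f : C -> C) (a b c d : R) : a <= b -> c <= d ->
  cont_bd f a b c d ->
  rect (fun z => k * f z)%C a b c d = (k * rect f a b c d)%C.
Proof.
  intros Hab Hcd Hf.
  destruct (cont_bd_rcont _ _ _ _ _ Hf) as [A1 [A2 [A3 A4]]].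
  unfold rect. rewrite !cint_scal by assumption. ring.
Qed.

Lemma rect_ext (f g : C -> C) (a b c d : R) : a <= b -> c <= d ->
  (forall x, a <= x <= b -> f (x, c) = g (x, c) /\ f (x, d) = g (x, d)) ->
  (forall y, c <= y <= d -> f (a, y) = g (a, y) /\ f (b, y) = g (b, y)) ->
  rect f a b c d = rect g a b c d.
Proof.
  intros Hab Hcd H K. unfold rect. f_equal; [f_equal|f_equal; f_equal].
  all: try apply (f_equal Copp).
  all: apply cint_ext; auto; intros t Ht; (apply (H t Ht) || apply (K t Ht)).
Qed.

Lemma rect_bound (f : C -> C) (a b c d M : R) : a <= b -> c <= d ->
  cont_bd f a b c d ->
  (forall x, a <= x <= b -> Cmod (f (x, c)) <= M /\ Cmod (f (x, d)) <= M) ->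
  (forall y, c <= y <= d -> Cmod (f (a, y)) <= M /\ Cmod (f (b, y)) <= M) ->
  Cmod (rect f a b c d) <= 2 * ((b - a) + (d - c)) * M.
Proof.
  intros Hab Hcd Hf H K.
  destruct (cont_bd_rcont _ _ _ _ _ Hf) as [A1 [A2 [A3 A4]]].
  assert (B1 := cint_bound _ _ _ M Hab A1 (fun t Ht => proj1 (H t Ht))).
  assert (B2 := cint_bound _ _ _ M Hab A2 (fun t Ht => proj2 (H t Ht))).
  assert (B3 := cint_bound _ _ _ M Hcd A3 (fun t Ht => proj1 (K t Ht))).
  assert (B4 := cint_bound _ _ _ M Hcd A4 (fun t Ht => proj2 (K t Ht))).
  unfold rect. eapply Rle_trans; [apply Cmod_triangle|].
  rewrite Cmod_mult, Cmod_Ci, Rmult_1_l.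
  eapply Rle_trans; [apply Rplus_le_compat; apply Cmod_triangle_sub|]. lra.
Qed.

Lemma cont_bd_intro (f : C -> C) (a b c d : R) : a <= b -> c <= d ->
  (forall x y, a <= x <= b -> c <= y <= d -> ccont f (x, y)) -> cont_bd f a b c d.
Proof. intros. repeat split; intros; apply H1; lra. Qed.

(** On opposite sides the integrands differ by a constant. The horizontal pair gives
    [(b - a) * q * Ci * (c - d)], the vertical pair the opposite value, so no antiderivative is
    involved. *)
Lemma rect_affine (p q : C) (a b c d : R) : a <= b -> c <= d ->
  rect (fun z => p + q * z)%C a b c d = RtoC 0.
Proof.
  intros Hab Hcd. unfold rect.
  assert (Hc : forall z, ccont (fun z => p + q * z)%C z).
  { intros z. apply ccont_plus; [apply ccont_const|].
    apply ccont_mult; [apply ccont_const|apply ccont_id]. }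
  assert (D : forall f g : R -> C, forall u v, u <= v -> rcont_on f u v -> rcont_on g u v ->
    forall k, (forall t, u <= t <= v -> (f t - g t)%C = k) ->
    (cint f u v - cint g u v)%C = (RtoC (v - u) * k)%C).
  { intros f g u v Huv F G k E.
    replace (cint f u v - cint g u v)%C with (cint f u v + (- (1)) * cint g u v)%C by ring.
    rewrite <- cint_scal, <- cint_plus; auto.
    - rewrite <- (cint_const k). apply cint_ext; auto.
      intros t Ht. rewrite <- (E t Ht). ring.
    - intros t Ht. apply rcont_scal. auto. }
  rewrite (D _ _ a b Hab
             (fun t Ht => rcont_hor _ t c (Hc _)) (fun t Ht => rcont_hor _ t d (Hc _))
             (q * (Ci * RtoC (c - d)))%C).
  2:{ intros t Ht. apply injective_projections; simpl; ring. }
  rewrite (D _ _ c d Hcd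
             (fun t Ht => rcont_ver _ b t (Hc _)) (fun t Ht => rcont_ver _ a t (Hc _))
             (q * (RtoC (b - a)))%C).
  2:{ intros t Ht. apply injective_projections; simpl; ring. }
  rewrite !RtoC_minus. ring.
Qed.

(** * Bisection and Goursat's theorem *)

Lemma nested_intervals (a b : nat -> R) :
  (forall n, a n <= a (S n)) -> (forall n, b (S n) <= b n) -> (forall n, a n <= b n) ->
  exists x, forall n, a n <= x <= b n.
Proof.
  intros Ha Hb Hab.
  assert (Ma : forall m n, (m <= n)%nat -> a m <= a n).
  { intros m n H. induction H; [lra|]. specialize (Ha m0); lra. }
  assert (Mb : forall m n, (m <= n)%nat -> b n <= b m).
  { intros m n H. induction H; [lra|]. specialize (Hb m0); lra. }
  assert (Mab : forall m n, a m <= b n).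
  { intros m n. assert (H1 := Ma m (max m n) ltac:(lia)).
    assert (H2 := Mb n (max m n) ltac:(lia)). specialize (Hab (max m n)). lra. }
  destruct (completeness (fun x => exists n, x = a n)) as [x [U L]].
  - exists (b 0%nat). intros y [n ->]. auto.
  - exists (a 0%nat). now exists 0%nat.
  - exists x. intros n. split.
    + apply U. now exists n.
    + apply L. intros y [m ->]. auto.
Qed.

(** If the property failed for the whole rectangle, it would fail for a nested sequence of quarters
    shrinking to a point, against the local hypothesis there. The level [n] is an argument of [P] so
    that a bound may depend on it, as in Goursat's theorem. Compactness of the closed disc is
    derived from the same principle. *)
Lemma bisection_2d (P : nat -> R -> R -> Prop) (x0 y0 U V : R) : 0 <= U -> 0 <= V ->
  (forall n x y,
     x0 <= x -> x + U / 2 ^ n <= x0 + U -> y0 <= y -> y + V / 2 ^ n <= y0 + V ->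
     P (S n) x y -> P (S n) (x + U / 2 ^ S n) y -> P (S n) x (y + V / 2 ^ S n) ->
     P (S n) (x + U / 2 ^ S n) (y + V / 2 ^ S n) -> P n x y) ->
  (forall X Y, x0 <= X <= x0 + U -> y0 <= Y <= y0 + V ->
     exists N, forall n x y, (N <= n)%nat ->
       x0 <= x -> x + U / 2 ^ n <= x0 + U -> y0 <= y -> y + V / 2 ^ n <= y0 + V ->
       x <= X <= x + U / 2 ^ n -> y <= Y <= y + V / 2 ^ n -> P n x y) ->
  P 0%nat x0 y0.
Proof.
  intros HU HV Hsplit Hloc. apply NNPP. intros Hnot.
  set (bad := fun n (s : R * R) =>
    x0 <= fst s /\ fst s + U / 2 ^ n <= x0 + U /\
    y0 <= snd s /\ snd s + V / 2 ^ n <= y0 + V /\ ~ P n (fst s) (snd s)).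
  set (next := fun n (s s' : R * R) => bad (S n) s' /\
    fst s <= fst s' /\ fst s' + U / 2 ^ S n <= fst s + U / 2 ^ n /\
    snd s <= snd s' /\ snd s' + V / 2 ^ S n <= snd s + V / 2 ^ n).
  assert (Hp : forall n, 0 < 2 ^ n) by (intros; apply pow_lt; lra).
  assert (Hhalf : forall W n, W / 2 ^ n = W / 2 ^ S n + W / 2 ^ S n).
  { intros W n. simpl. field. specialize (Hp n). lra. }
  assert (Hq : forall W n, 0 <= W -> 0 <= W / 2 ^ n).
  { intros W n HW. apply Rmult_le_pos; auto. left. apply Rinv_0_lt_compat, Hp. }
  (* The implication stands under the existential quantifier so that the choice function [nx] is
     total. *)
  assert (Hnext : forall n s, exists s', bad n s -> next n s s').
  { intros n [x y]. destruct (classic (bad n (x, y))) as [Hb|Hb].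
    2:{ exists (x, y). tauto. }
    assert (HE : exists s', next n (x, y) s').
    { apply NNPP. intros Hno. unfold bad in Hb. cbn [fst snd] in Hb.
      destruct Hb as [B1 [B2 [B3 [B4 B5]]]].
      assert (HqU := Hq U (S n) HU). assert (HqV := Hq V (S n) HV).
      assert (EU := Hhalf U n). assert (EV := Hhalf V n).
      apply B5. apply Hsplit; auto; apply NNPP; intros K; apply Hno;
      [exists (x, y)|exists (x + U / 2 ^ S n, y)|exists (x, y + V / 2 ^ S n)
      |exists (x + U / 2 ^ S n, y + V / 2 ^ S n)];
      unfold next, bad; cbn [fst snd];
      repeat split; auto; lra. }
    destruct HE as [s' Hs']. exists s'. auto. }
  set (nx := fun n s => proj1_sig (constructive_indefinite_description _ (Hnext n s))).
  set (seq := fix seq n := match n with O => (x0, y0) | S k => nx k (seq k) end).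
  assert (Hbad0 : bad 0%nat (seq 0%nat)).
  { unfold bad, seq; simpl. repeat split; auto; lra. }
  assert (Hstep : forall n, bad n (seq n) -> next n (seq n) (seq (S n))).
  { intros n Hb. change (seq (S n)) with (nx n (seq n)). unfold nx.
    destruct (constructive_indefinite_description _ (Hnext n (seq n))) as [s' Hs']. auto. }
  assert (Hbad : forall n, bad n (seq n)).
  { induction n; auto. now apply Hstep. }
  destruct (nested_intervals (fun n => fst (seq n)) (fun n => fst (seq n) + U / 2 ^ n)) as [X HX].
  { intros n. apply (Hstep n (Hbad n)). }
  { intros n. apply (Hstep n (Hbad n)). }
  { intros n. specialize (Hq U n HU). lra. }
  destruct (nested_intervals (fun n => snd (seq n)) (fun n => snd (seq n) + V / 2 ^ n)) as [Y HY].
  { intros n. apply (Hstep n (Hbad n)). }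
  { intros n. apply (Hstep n (Hbad n)). }
  { intros n. specialize (Hq V n HV). lra. }
  destruct (Hloc X Y) as [N HN].
  - generalize (HX 0%nat). simpl. lra.
  - generalize (HY 0%nat). simpl. lra.
  - destruct (Hbad N) as [B1 [B2 [B3 [B4 B5]]]]. apply B5. apply HN; auto.
Qed.

Lemma pow2_small (L d : R) : 0 < d -> exists N, forall n, (N <= n)%nat -> L / 2 ^ n < d.
Proof.
  intros Hd. destruct (pow_lt_1_zero (/ 2)) with (y := d / (Rabs L + 1)) as [N HN].
  - rewrite Rabs_right; lra.
  - apply Rdiv_lt_0_compat; auto. generalize (Rabs_pos L); lra.
  - exists N. intros n Hn. specialize (HN n Hn).
    rewrite Rabs_right in HN by (apply Rle_ge, pow_le; lra).
    assert (P := Rabs_pos L). assert (Q := Rle_abs L).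
    unfold Rdiv. rewrite <- pow_inv.
    assert (0 <= (/ 2) ^ n) by (apply pow_le; lra).
    apply (Rmult_lt_compat_r (Rabs L + 1)) in HN; [|lra].
    unfold Rdiv in HN. rewrite Rmult_assoc, Rinv_l in HN; nra.
Qed.

Lemma goursat (f : C -> C) (a b c d : R) : a <= b -> c <= d ->
  (forall x y, a <= x <= b -> c <= y <= d -> exists l, cdiff f (x, y) l) ->
  rect f a b c d = RtoC 0.
Proof.
  intros Hab Hcd Hf. apply Cmod_eq_0. apply Rle_antisym; [|apply Cmod_ge_0].
  apply le_epsilon. intros e He. rewrite Rplus_0_l.
  set (U := b - a). set (V := d - c). set (L := U + V).
  assert (HU : 0 <= U) by (unfold U; lra). assert (HV : 0 <= V) by (unfold V; lra).
  assert (Hp : forall n, 0 < 2 ^ n) by (intros; apply pow_lt; lra).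
  assert (Hq : forall W n, 0 <= W -> 0 <= W / 2 ^ n).
  { intros W n HW. apply Rmult_le_pos; auto. left. apply Rinv_0_lt_compat, Hp. }
  assert (HC : forall x y, a <= x <= b -> c <= y <= d -> ccont f (x, y)).
  { intros x y Hx Hy. destruct (Hf x y Hx Hy) as [l Hl]. eapply cdiff_ccont, Hl. }
  (* The bound [e / 4 ^ n] is additive: four quarters at level [S n] add up to exactly the bound at
     level [n]. *)
  assert (K := bisection_2d (fun n x y =>
    Cmod (rect f x (x + U / 2 ^ n) y (y + V / 2 ^ n)) <= e / 4 ^ n) a c U V HU HV).
  cbv beta in K. lapply K; clear K; [intros K; lapply K; clear K; [intros K|]|].
  - simpl in K. unfold U, V in K.
    replace (a + (b - a) / 1) with b in K by field.
    replace (c + (d - c) / 1) with d in K by field. lra.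
  - intros X Y HX HY.
    destruct (Hf X Y) as [l Hl]; [unfold U in HX; lra|unfold V in HY; lra|].
    assert (HL : 0 <= L) by (unfold L; lra).
    (* At level [n] the perimeter is [2 * (L / 2 ^ n)] and the distance to [z] at most [L / 2 ^ n],
       which produces [2 * L ^ 2 / 4 ^ n]; the summand 1 covers [L = 0]. *)
    destruct (Hl (e / (2 * L ^ 2 + 1))) as [dl [Hdl H1]].
    { apply Rdiv_lt_0_compat; auto. nra. }
    destruct (pow2_small L dl Hdl) as [N HN].
    exists N. intros n x y Hn A1 A2 A3 A4 A5 A6.
    specialize (HN n Hn).
    assert (QU := Hq U n HU). assert (QV := Hq V n HV).
    assert (EL : L / 2 ^ n = U / 2 ^ n + V / 2 ^ n) by (unfold L; field; specialize (Hp n); lra).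
    assert (E4 : 4 ^ n = 2 ^ n * 2 ^ n) by (rewrite <- Rpow_mult_distr; f_equal; ring).
    set (z := (X, Y) : C).
    (* Tangent map and remainder: the tangent map integrates to 0, so only the remainder counts. *)
    set (A := fun w : C => ((f z - l * z) + l * w)%C).
    set (E := fun w : C => (f w - f z - l * (w - z))%C).
    assert (CA : forall w, ccont A w).
    { intros w. apply ccont_plus; [apply ccont_const|].
      apply ccont_mult; [apply ccont_const|apply ccont_id]. }
    assert (CE : forall w, ccont f w -> ccont E w).
    { intros w Hw. apply (ccont_ext_loc (fun w => f w + - A w)%C _ _ 1); [lra| |].
      - intros t _. unfold A, E. ring.
      - apply ccont_plus; auto. apply ccont_opp, CA. }
    set (u := U / 2 ^ n) in *. set (v := V / 2 ^ n) in *.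
    unfold U, V in A2, A4.
    assert (BE : cont_bd E x (x + u) y (y + v)).
    { apply cont_bd_intro; try lra. intros; apply CE, HC; lra. }
    assert (BA : cont_bd A x (x + u) y (y + v)).
    { apply cont_bd_intro; try lra. intros; apply CA. }
    rewrite (rect_ext f (fun w => A w + E w)%C);
      [|lra|lra|intros; unfold A, E; split; ring|intros; unfold A, E; split; ring].
    rewrite rect_plus by (auto; lra).
    replace (rect A x (x + u) y (y + v)) with (RtoC 0) by (symmetry; apply rect_affine; lra).
    rewrite Cplus_0_l.
    assert (BB : forall s t, x <= s <= x + u -> y <= t <= y + v ->
      Cmod (E (s, t)) <= e / (2 * L ^ 2 + 1) * (L / 2 ^ n)).
    { intros s t Hs Ht. assert (Hw : Cmod ((s, t) - z) <= u + v).
      { eapply Rle_trans; [apply Cmod_le_Re_Im|].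
        unfold z; simpl. apply Rplus_le_compat; apply Rabs_le; lra. }
      eapply Rle_trans; [apply H1; fold z; lra|].
      apply Rmult_le_compat_l; [|fold z; lra].
      left. apply Rdiv_lt_0_compat; auto. nra. }
    eapply Rle_trans; [apply rect_bound with (M := e / (2 * L ^ 2 + 1) * (L / 2 ^ n)); auto; try lra|].
    * intros; split; apply BB; lra.
    * intros; split; apply BB; lra.
    * replace (2 * (x + u - x + (y + v - y))) with (2 * (L / 2 ^ n)) by lra.
      rewrite E4. specialize (Hp n).
      replace (2 * (L / 2 ^ n) * (e / (2 * L ^ 2 + 1) * (L / 2 ^ n)))
        with (e / (2 ^ n * 2 ^ n) * (2 * L ^ 2 / (2 * L ^ 2 + 1))) by (field; split; nra).
      rewrite <- (Rmult_1_r (e / (2 ^ n * 2 ^ n))) at 2.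
      apply Rmult_le_compat_l.
      { left. apply Rdiv_lt_0_compat; auto. nra. }
      assert (HL2 := pow2_ge_0 L).
      apply Rle_div_l; lra.
  - intros n x y A1 A2 A3 A4 P1 P2 P3 P4.
    assert (EU : U / 2 ^ n = U / 2 ^ S n + U / 2 ^ S n) by (simpl; field; specialize (Hp n); lra).
    assert (EV : V / 2 ^ n = V / 2 ^ S n + V / 2 ^ S n) by (simpl; field; specialize (Hp n); lra).
    assert (QU := Hq U (S n) HU). assert (QV := Hq V (S n) HV).
    assert (Ee : e / 4 ^ n = 4 * (e / 4 ^ S n)).
    { simpl. field. apply pow_nonzero. lra. }
    rewrite EU, EV, <- !Rplus_assoc. rewrite EU in A2. rewrite EV in A4.
    set (u := U / 2 ^ S n) in *. set (v := V / 2 ^ S n) in *. clearbody u v.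
    unfold U, V in A2, A4.
    rewrite (rect_split_x f x (x + u)) by (try apply cont_bd_intro; try lra; intros; apply HC; lra).
    rewrite (rect_split_y f x (x + u) y (y + v) (y + v + v)),
      (rect_split_y f (x + u) (x + u + u) y (y + v) (y + v + v))
      by (try apply cont_bd_intro; try lra; intros; apply HC; lra).
    eapply Rle_trans; [apply Cmod_triangle|].
    eapply Rle_trans; [apply Rplus_le_compat; apply Cmod_triangle|].
    lra.
Qed.

Lemma Re_minus (a b : C) : Re (a - b)%C = Re a - Re b.
Proof. unfold Re. simpl. ring. Qed.

Lemma Im_minus (a b : C) : Im (a - b)%C = Im a - Im b.
Proof. unfold Im. simpl. ring. Qed.

(** Goursat's theorem disposes of the four rectangles around a small square centred at the
    exceptional point. On that square [f] is bounded, so its contribution tends to 0 with the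
    perimeter. *)
Lemma rect_removable (f : C -> C) (a b c d p q : R) : a < p < b -> c < q < d ->
  (forall x y, a <= x <= b -> c <= y <= d -> (x, y) <> (p, q) -> exists l, cdiff f (x, y) l) ->
  (exists B delta, 0 < delta /\
     forall z, z <> (p, q) -> Cmod (z - (p, q)) < delta -> Cmod (f z) <= B) ->
  rect f a b c d = RtoC 0.
Proof.
  intros Hp Hq Hf [B [dl [Hdl HB]]]. apply Cmod_eq_0. apply Rle_antisym; [|apply Cmod_ge_0].
  apply le_epsilon. intros eta Heta. rewrite Rplus_0_l.
  set (B' := Rmax B 0 + 1).
  assert (HB' : 0 < B' /\ B <= B').
  { unfold B'. generalize (Rmax_l B 0) (Rmax_r B 0). lra. }
  set (m := Rmin (Rmin (p - a) (b - p)) (Rmin (q - c) (d - q))).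
  (* The first entry keeps the square inside the rectangle, the second keeps its boundary within
     [dl] of the point, and the third bounds perimeter times [B'], that is [8 * e * B'], by
     [eta / 2]. *)
  set (e := Rmin (m / 2) (Rmin (dl / 4) (eta / (16 * B')))).
  assert (E1 : e <= m / 2) by apply Rmin_l.
  assert (E2 : e <= dl / 4) by (eapply Rle_trans; [apply Rmin_r|apply Rmin_l]).
  assert (E3 : e <= eta / (16 * B')) by (eapply Rle_trans; [apply Rmin_r|apply Rmin_r]).
  assert (M1 : m <= p - a) by (eapply Rle_trans; [apply Rmin_l|apply Rmin_l]).
  assert (M2 : m <= b - p) by (eapply Rle_trans; [apply Rmin_l|apply Rmin_r]).
  assert (M3 : m <= q - c) by (eapply Rle_trans; [apply Rmin_r|apply Rmin_l]).
  assert (M4 : m <= d - q) by (eapply Rle_trans; [apply Rmin_r|apply Rmin_r]).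
  assert (Hm : 0 < m) by (repeat apply Rmin_glb_lt; lra).
  assert (He : 0 < e).
  { repeat apply Rmin_glb_lt; try lra. apply Rdiv_lt_0_compat; lra. }
  clearbody m e.
  assert (Hne1 : forall x y : R, x <> p -> (x, y) <> (p, q)) by (intros x y H K; inversion K; auto).
  assert (Hne2 : forall x y : R, y <> q -> (x, y) <> (p, q)) by (intros x y H K; inversion K; auto).
  assert (HC : forall x y, a <= x <= b -> c <= y <= d -> (x, y) <> (p, q) -> ccont f (x, y)).
  { intros x y Hx Hy Hn. destruct (Hf x y Hx Hy Hn) as [l Hl]. eapply cdiff_ccont, Hl. }
  assert (HBd : forall a' b' c' d', a <= a' -> b' <= b -> c <= c' -> d' <= d ->
    a' <= b' -> c' <= d' -> a' <> p -> b' <> p -> c' <> q -> d' <> q -> cont_bd f a' b' c' d').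
  { intros. repeat split; intros; apply HC; try lra; auto. }
  assert (HG : forall a' b' c' d', a <= a' <= b' -> b' <= b -> c <= c' <= d' -> d' <= d ->
    (b' < p \/ p < a' \/ d' < q \/ q < c') -> rect f a' b' c' d' = RtoC 0).
  { intros a' b' c' d' A1 A2 A3 A4 A5. apply goursat; try lra.
    intros x y Hx Hy. apply Hf; try lra. destruct A5 as [A5|[A5|[A5|A5]]].
    - apply Hne1; lra.
    - apply Hne1; lra.
    - apply Hne2; lra.
    - apply Hne2; lra. }
  rewrite (rect_split_x f a (p - e) b) by (lra || (apply HBd; lra)).
  rewrite (rect_split_x f (p - e) (p + e) b) by (lra || (apply HBd; lra)).
  rewrite (rect_split_y f (p - e) (p + e) c (q - e) d) by (lra || (apply HBd; lra)).
  rewrite (rect_split_y f (p - e) (p + e) (q - e) (q + e) d) by (lra || (apply HBd; lra)).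
  rewrite (HG a), (HG (p + e)), (HG (p - e) (p + e) c), (HG (p - e) (p + e) (q + e)) by lra.
  rewrite !Cplus_0_l, !Cplus_0_r.
  assert (Hsmall : forall x y, p - e <= x <= p + e -> q - e <= y <= q + e ->
    Cmod ((x, y) - (p, q)) < dl).
  { intros x y Hx Hy. eapply Rle_lt_trans; [apply Cmod_le_Re_Im|]. simpl.
    assert (Rabs (x + - p) <= e) by (apply Rabs_le; lra).
    assert (Rabs (y + - q) <= e) by (apply Rabs_le; lra). lra. }
  eapply Rle_trans; [apply rect_bound with (M := B'); try lra; [apply HBd; lra| |]|].
  - intros x Hx. split; (eapply Rle_trans; [apply HB|apply HB']); try (apply Hne2; lra);
    apply Hsmall; lra.
  - intros x Hx. split; (eapply Rle_trans; [apply HB|apply HB']); try (apply Hne1; lra);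
    apply Hsmall; lra.
  - assert (E4 : e * (16 * B') <= eta).
    { apply Rle_div_r; lra. }
    nra.
Qed.

(** * Cauchy's formula on a square *)

Definition on_bd (a b c d : R) (z : C) : Prop :=
  a <= Re z <= b /\ c <= Im z <= d /\ (Re z = a \/ Re z = b \/ Im z = c \/ Im z = d).

Lemma cont_bd_on_bd (f : C -> C) (a b c d : R) : a <= b -> c <= d ->
  (forall z, on_bd a b c d z -> ccont f z) -> cont_bd f a b c d.
Proof. intros Hab Hcd H. repeat split; intros; apply H; unfold on_bd; simpl; lra. Qed.

Lemma rect_ext_bd (f g : C -> C) (a b c d : R) : a <= b -> c <= d ->
  (forall z, on_bd a b c d z -> f z = g z) -> rect f a b c d = rect g a b c d.
Proof.
  intros Hab Hcd H. apply rect_ext; auto; intros t Ht; split; apply H; unfold on_bd; simpl; lra.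
Qed.

(** The difference quotient of [f] at [w] is bounded near [w], so its integral vanishes. The kernel
    integral stays as an unevaluated factor, and its [1 *] gives it the shape of the left side for
    the constant function 1. *)
Lemma cauchy_square (f : C -> C) (a b c d : R) (w : C) :
  a < Re w < b -> c < Im w < d ->
  (forall x y, a <= x <= b -> c <= y <= d -> exists l, cdiff f (x, y) l) ->
  rect (fun z => f z * / (z - w))%C a b c d = (f w * rect (fun z => 1 * / (z - w))%C a b c d)%C.
Proof.
  intros Hp Hq Hf.
  assert (Hw : (Re w, Im w) = w) by (destruct w; reflexivity).
  assert (Hne : forall z, on_bd a b c d z -> (z - w)%C <> RtoC 0).
  { intros z [_ [_ H]]. apply Cminus_eq_contra. intros ->. lra. }
  assert (Hinv : forall z, (z - w)%C <> RtoC 0 -> ccont (fun z => / (z - w))%C z).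
  { intros z Hz. apply (ccont_inv (fun z => z - w)%C); auto.
    apply (ccont_plus (fun z => z) (fun _ => - w)%C); [apply ccont_id|apply ccont_const]. }
  assert (C1 : cont_bd (fun z => f z * / (z - w))%C a b c d).
  { apply cont_bd_on_bd; try lra. intros [x y] Hz. apply ccont_mult; [|apply Hinv, Hne, Hz].
    destruct Hz as [H1 [H2 _]]. destruct (Hf x y) as [l Hl]; auto. eapply cdiff_ccont, Hl. }
  assert (C2 : cont_bd (fun z => 1 * / (z - w))%C a b c d).
  { apply cont_bd_on_bd; try lra. intros z Hz. apply ccont_mult; [apply ccont_const|apply Hinv, Hne, Hz]. }
  assert (Z : rect (fun z => (f z - f w) / (z - w))%C a b c d = RtoC 0).
  { apply (rect_removable _ a b c d (Re w) (Im w)); auto; rewrite Hw.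
    - intros x y Hx Hy Hn. destruct (Hf x y Hx Hy) as [l Hl]. eexists.
      apply (cdiff_div (fun z => f z - f w)%C (fun z => z - w)%C).
      + now apply Cminus_eq_contra.
      + apply (cdiff_minus f (fun _ => f w)); [exact Hl|apply cdiff_const].
      + apply (cdiff_minus (fun z => z) (fun _ => w)); [apply cdiff_id|apply cdiff_const].
    - destruct (Hf (Re w) (Im w)) as [l Hl]; try lra. rewrite Hw in Hl.
      destruct (Hl 1 Rlt_0_1) as [dl [Hdl H]].
      exists (Cmod l + 1), dl. split; auto. intros z Hz Hzd.
      rewrite Cmod_div by now apply Cminus_eq_contra.
      apply Rle_div_l; [now apply Cmod_sub_pos|].
      specialize (H z Hzd).
      replace (f z - f w)%C with ((f z - f w - l * (z - w)) + l * (z - w))%C by ring.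
      eapply Rle_trans; [apply Cmod_triangle|]. rewrite Cmod_mult. lra. }
  rewrite (rect_ext_bd _ (fun z => f z * / (z - w) + (- f w) * (1 * / (z - w)))%C) in Z;
    [|lra|lra|intros z Hz; field; now apply Hne].
  assert (C3 : cont_bd (fun z => - f w * (1 * / (z - w)))%C a b c d).
  { apply cont_bd_on_bd; try lra. intros z Hz. apply ccont_mult; [apply ccont_const|].
    apply ccont_mult; [apply ccont_const|apply Hinv, Hne, Hz]. }
  rewrite (rect_plus (fun z => f z * / (z - w))%C (fun z => - f w * (1 * / (z - w)))%C) in Z
    by (auto; lra).
  rewrite (rect_scal (- f w)%C (fun z => 1 * / (z - w))%C) in Z by (auto; lra).
  apply Ceq_minus. rewrite <- Z. ring.
Qed.

(** Compactness of the closed disc, by bisection of the circumscribed square. Assuming only local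
    boundedness lets it be applied to reciprocals such as [/ (M - u z)]. *)
Lemma disc_bounded (u : C -> R) (c : C) (rho : R) : 0 <= rho ->
  (forall z, Cmod (z - c) <= rho -> exists delta B, 0 < delta /\
     forall w, Cmod (w - c) <= rho -> Cmod (w - z) < delta -> u w <= B) ->
  exists B, forall w, Cmod (w - c) <= rho -> u w <= B.
Proof.
  intros Hr Hloc.
  set (U := 2 * rho).
  assert (HU : 0 <= U) by (unfold U; lra).
  assert (K := bisection_2d (fun n x y => exists B, forall w, Cmod (w - c) <= rho ->
     x <= Re w <= x + U / 2 ^ n -> y <= Im w <= y + U / 2 ^ n -> u w <= B)
     (Re c - rho) (Im c - rho) U U HU HU).
  cbv beta in K. lapply K; clear K; [intros K; lapply K; clear K; [intros [B HB]|]|].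
  - exists B. intros w Hw. apply HB; auto; simpl; unfold U.
    + assert (H := re_le_Cmod (w - c)).
      assert (E : Re (w - c)%C = Re w - Re c) by apply Re_minus. rewrite E in H.
      apply Rabs_le_between in H. lra.
    + assert (H := Im_le_Cmod (w - c)).
      assert (E : Im (w - c)%C = Im w - Im c) by apply Im_minus. rewrite E in H.
      apply Rabs_le_between in H. lra.
  - intros X Y HX HY.
    assert (HL : exists delta B, 0 < delta /\
      forall w, Cmod (w - c) <= rho -> Cmod (w - (X, Y)) < delta -> u w <= B).
    { destruct (Rle_dec (Cmod ((X, Y) - c)) rho) as [H|H]; [now apply Hloc|].
      (* A corner of the square may lie outside the disc; a neighbourhood of such a point misses the
         disc, and the bound 0 is vacuous. *)
      exists (Cmod ((X, Y) - c) - rho), 0. split; [lra|]. intros w H1 H2. exfalso.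
      generalize (Cmod_dist_triangle (X, Y) w c). rewrite (Cmod_sym (X, Y) w). lra. }
    destruct HL as [dl [B [Hdl HB]]].
    destruct (pow2_small (2 * U) dl Hdl) as [N HN]. exists N.
    intros n x y Hn _ _ _ _ Hx Hy. exists B. intros w Hw Hwx Hwy. apply HB; auto.
    specialize (HN n Hn). unfold Rdiv in HN, Hx, Hy, Hwx, Hwy.
    eapply Rle_lt_trans; [apply Cmod_le_Re_Im|].
    assert (Rabs (Re (w - (X, Y))%C) <= U * / 2 ^ n)
      by (apply Rabs_le; unfold Re in *; simpl; lra).
    assert (Rabs (Im (w - (X, Y))%C) <= U * / 2 ^ n)
      by (apply Rabs_le; unfold Im in *; simpl; lra).
    lra.
  - intros n x y _ _ _ _ [B1 H1] [B2 H2] [B3 H3] [B4 H4].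
    exists (Rmax (Rmax B1 B2) (Rmax B3 B4)). intros w Hw Hwx Hwy.
    assert (EU : U / 2 ^ n = U / 2 ^ S n + U / 2 ^ S n)
      by (simpl; field; apply pow_nonzero; lra).
    rewrite EU in Hwx, Hwy.
    assert (M1 := Rmax_l (Rmax B1 B2) (Rmax B3 B4)).
    assert (M2 := Rmax_r (Rmax B1 B2) (Rmax B3 B4)).
    assert (M3 := Rmax_l B1 B2). assert (M4 := Rmax_r B1 B2).
    assert (M5 := Rmax_l B3 B4). assert (M6 := Rmax_r B3 B4).
    set (v := U / 2 ^ S n) in *.
    destruct (Rle_dec (Re w) (x + v)); destruct (Rle_dec (Im w) (y + v)).
    + assert (u w <= B1) by (apply H1; auto; lra). lra.
    + assert (u w <= B3) by (apply H3; auto; lra). lra.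
    + assert (u w <= B2) by (apply H2; auto; lra). lra.
    + assert (u w <= B4) by (apply H4; auto; lra). lra.
Qed.

(** If the supremum [M] were not attained, [/ (M - u z)] would be locally bounded, hence bounded by
    some [B'], and [M - / B'] would be a smaller upper bound. *)
Lemma disc_max (u : C -> R) (c : C) (rho : R) : 0 <= rho ->
  (forall z, Cmod (z - c) <= rho -> forall eps, 0 < eps -> exists delta, 0 < delta /\
     forall w, Cmod (w - c) <= rho -> Cmod (w - z) < delta -> Rabs (u w - u z) < eps) ->
  exists z, Cmod (z - c) <= rho /\ forall w, Cmod (w - c) <= rho -> u w <= u z.
Proof.
  intros Hr Hu.
  destruct (disc_bounded u c rho Hr) as [B HB].
  { intros z Hz. destruct (Hu z Hz 1 Rlt_0_1) as [dl [Hdl H]].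
    exists dl, (u z + 1). split; auto. intros w H1 H2. specialize (H w H1 H2).
    apply Rabs_lt_between in H. lra. }
  destruct (completeness (fun v => exists w, Cmod (w - c) <= rho /\ v = u w)) as [M [UB LUB]].
  { exists B. intros v [w [Hw ->]]. auto. }
  { exists (u c), c. split; auto. rewrite Cmod_sub_diag. auto. }
  apply NNPP. intros Hno.
  assert (Hlt : forall z, Cmod (z - c) <= rho -> u z < M).
  { intros z Hz. assert (H : u z <= M) by (apply UB; eauto).
    destruct H as [H|H]; auto. exfalso. apply Hno. exists z. split; auto.
    intros w Hw. rewrite H. apply UB; eauto. }
  destruct (disc_bounded (fun z => / (M - u z)) c rho Hr) as [B' HB'].
  { intros z Hz. assert (L := Hlt z Hz).
    destruct (Hu z Hz ((M - u z) / 2)) as [dl [Hdl H]]; [lra|].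
    exists dl, (2 / (M - u z)). split; auto. intros w H1 H2. specialize (H w H1 H2).
    apply Rabs_lt_between in H.
    replace (2 / (M - u z)) with (/ ((M - u z) / 2)) by (field; lra).
    apply Rinv_le_contravar; lra. }
  assert (HB0 : 0 < B').
  { eapply Rlt_le_trans; [|apply (HB' c); rewrite Cmod_sub_diag; auto].
    apply Rinv_0_lt_compat. assert (u c < M) by (apply Hlt; rewrite Cmod_sub_diag; auto). lra. }
  assert (M <= M - / B').
  { apply LUB. intros v [w [Hw ->]]. specialize (HB' w Hw). specialize (Hlt w Hw).
    assert (0 < / (M - u w)) by (apply Rinv_0_lt_compat; lra).
    apply Rinv_le_contravar in HB'; auto. rewrite Rinv_inv in HB'. lra. }
  assert (0 < / B') by now apply Rinv_0_lt_compat. lra.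
Qed.

(** Differentiation under the integral sign. The remainder is quadratic in [w - w0] uniformly on the
    boundary, so after integration it is still at most a constant times [Cmod (w - w0) ^ 2]. *)
Lemma rect_param_cdiff (K : C -> C -> C) (K' : C -> C) (a b c d : R) (w0 : C) (r A : R) :
  a <= b -> c <= d -> 0 < r -> 0 <= A ->
  (forall w, Cmod (w - w0) < r -> forall z, on_bd a b c d z -> ccont (K w) z) ->
  (forall z, on_bd a b c d z -> ccont K' z) ->
  (forall w, Cmod (w - w0) < r -> forall z, on_bd a b c d z ->
     Cmod (K w z - K w0 z - K' z * (w - w0)) <= A * Cmod (w - w0) ^ 2) ->
  cdiff (fun w => rect (K w) a b c d) w0 (rect K' a b c d).
Proof.
  intros Hab Hcd Hr HA HK HK' HE e He.
  set (L := 2 * ((b - a) + (d - c))).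
  assert (HL : 0 <= L) by (unfold L; lra).
  assert (HLA : 0 <= L * A) by now apply Rmult_le_pos.
  exists (Rmin r (e / (L * A + 1))). split.
  { apply Rmin_glb_lt; auto. apply Rdiv_lt_0_compat; lra. }
  intros w Hw.
  assert (W1 : Cmod (w - w0) < r) by (eapply Rlt_le_trans; [exact Hw|apply Rmin_l]).
  assert (W2 : Cmod (w - w0) < e / (L * A + 1)) by (eapply Rlt_le_trans; [exact Hw|apply Rmin_r]).
  assert (W0 : Cmod (w0 - w0) < r) by now rewrite Cmod_sub_diag.
  assert (B1 : cont_bd (K w) a b c d) by (apply cont_bd_on_bd; auto).
  assert (B2 : cont_bd (K w0) a b c d) by (apply cont_bd_on_bd; auto).
  assert (B3 : cont_bd K' a b c d) by (apply cont_bd_on_bd; auto).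
  assert (B4 : cont_bd (fun z => - (1) * K w0 z)%C a b c d).
  { apply cont_bd_on_bd; auto. intros z Hz. apply ccont_mult; [apply ccont_const|auto]. }
  assert (B5 : cont_bd (fun z => - (w - w0) * K' z)%C a b c d).
  { apply cont_bd_on_bd; auto. intros z Hz. apply ccont_mult; [apply ccont_const|auto]. }
  assert (B6 : cont_bd (fun z => - (1) * K w0 z + - (w - w0) * K' z)%C a b c d).
  { apply cont_bd_on_bd; auto. intros z Hz.
    apply ccont_plus; (apply ccont_mult; [apply ccont_const|auto]). }
  assert (B7 : cont_bd (fun z => K w z + (- (1) * K w0 z + - (w - w0) * K' z))%C a b c d).
  { apply cont_bd_on_bd; auto. intros z Hz. apply ccont_plus; [auto|].
    apply ccont_plus; (apply ccont_mult; [apply ccont_const|auto]). }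
  replace (rect (K w) a b c d - rect (K w0) a b c d - rect K' a b c d * (w - w0))%C
    with (rect (fun z => K w z + (- (1) * K w0 z + - (w - w0) * K' z))%C a b c d).
  2:{ rewrite rect_plus, rect_plus, !rect_scal by auto. ring. }
  assert (HB : forall z, on_bd a b c d z ->
    Cmod (K w z + (- (1) * K w0 z + - (w - w0) * K' z)) <= A * Cmod (w - w0) ^ 2).
  { intros z Hz. eapply Rle_trans; [|apply (HE w W1 z Hz)]. right. f_equal. ring. }
  eapply Rle_trans; [apply rect_bound with (M := A * Cmod (w - w0) ^ 2); auto|].
  - intros x Hx. split; apply HB; unfold on_bd; simpl; lra.
  - intros x Hx. split; apply HB; unfold on_bd; simpl; lra.
  - fold L. assert (P := Cmod_ge_0 (w - w0)).
    assert (Cmod (w - w0) * (L * A + 1) <= e) by (apply Rle_div_r; lra).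
    nra.
Qed.

(** The Taylor remainders of 1/(z - w) and 1/(z - w)^2 in [w] are exact rational expressions with a
    factor [(w - w0) ^ 2]. The distance [2 * r] leaves [r] between the boundary and every [w] within
    [r] of [w0], which gives the constants [M / r ^ 3] and [3 * M / r ^ 4]. *)
Lemma cauchy_kernel_cdiff (phi : C -> C) (a b c d r M : R) (w0 : C) :
  a <= b -> c <= d -> 0 < r ->
  (forall z, on_bd a b c d z -> 2 * r <= Cmod (z - w0) /\ Cmod (phi z) <= M /\ ccont phi z) ->
  cdiff (fun w => rect (fun z => phi z * / (z - w))%C a b c d) w0
    (rect (fun z => phi z * (/ (z - w0) * / (z - w0)))%C a b c d) /\
  exists l, cdiff (fun w => rect (fun z => phi z * (/ (z - w) * / (z - w)))%C a b c d) w0 l.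
Proof.
  intros Hab Hcd Hr Hbd.
  assert (Hfar : forall w, Cmod (w - w0) < r -> forall z, on_bd a b c d z ->
    r <= Cmod (z - w) /\ z <> w /\ Cmod (/ (z - w)) <= / r).
  { intros w Hw z Hz. destruct (Hbd z Hz) as [H _].
    assert (H1 : r <= Cmod (z - w)) by (generalize (Cmod_dist_triangle z w w0); lra).
    assert (H2 : z <> w) by (intros ->; rewrite Cmod_sub_diag in H1; lra).
    split; [|split]; auto. rewrite Cmod_inv by now apply Cminus_eq_contra.
    now apply Rinv_le_contravar. }
  assert (W0 : Cmod (w0 - w0) < r) by now rewrite Cmod_sub_diag.
  assert (Hinv : forall w, Cmod (w - w0) < r -> forall z, on_bd a b c d z ->
    ccont (fun z => / (z - w))%C z).
  { intros w Hw z Hz. destruct (Hfar w Hw z Hz) as [_ [Hn _]].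
    apply (ccont_inv (fun z => z - w)%C); [now apply Cminus_eq_contra|].
    apply (ccont_plus (fun z => z) (fun _ => - w)%C); [apply ccont_id|apply ccont_const]. }
  assert (Hir : 0 < / r) by now apply Rinv_0_lt_compat.
  assert (HM : 0 <= M).
  { destruct (Hbd (a, c)) as [_ [H _]]; [unfold on_bd; simpl; lra|].
    eapply Rle_trans; [apply Cmod_ge_0|exact H]. }
  split; [|eexists].
  - apply (rect_param_cdiff (fun w z => phi z * / (z - w))%C _ a b c d w0 r (M * (/ r * (/ r * / r))));
      auto.
    + apply Rmult_le_pos; auto. nra.
    + intros w Hw z Hz. apply ccont_mult; [apply Hbd; auto|now apply Hinv].
    + intros z Hz. apply ccont_mult; [apply Hbd; auto|].
      apply ccont_mult; now apply Hinv.
    + intros w Hw z Hz. destruct (Hfar w Hw z Hz) as [_ [N1 I1]].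
      destruct (Hfar w0 W0 z Hz) as [_ [N2 I2]]. destruct (Hbd z Hz) as [_ [Hphi _]].
      replace (phi z * / (z - w) - phi z * / (z - w0) - phi z * (/ (z - w0) * / (z - w0)) * (w - w0))%C
        with (phi z * (/ (z - w) * (/ (z - w0) * / (z - w0))) * ((w - w0) * (w - w0)))%C
        by (field; split; now apply Cminus_eq_contra).
      rewrite !Cmod_mult.
      replace (Cmod (w - w0) ^ 2) with (Cmod (w - w0) * Cmod (w - w0)) by ring.
      apply Rmult_le_compat_r; [apply Rmult_le_pos; apply Cmod_ge_0|].
      repeat (apply Rmult_le_compat; repeat apply Rmult_le_pos; auto using Cmod_ge_0).
  - apply (rect_param_cdiff (fun w z => phi z * (/ (z - w) * / (z - w)))%C
      (fun z => phi z * (2 * (/ (z - w0) * (/ (z - w0) * / (z - w0)))))%C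
      a b c d w0 r (M * (/ r * (/ r * / r) * (3 * / r)))); auto.
    + apply Rmult_le_pos; auto. repeat apply Rmult_le_pos; lra.
    + intros w Hw z Hz. apply ccont_mult; [apply Hbd; auto|]. apply ccont_mult; now apply Hinv.
    + intros z Hz. apply ccont_mult; [apply Hbd; auto|]. apply ccont_mult; [apply ccont_const|].
      apply ccont_mult; [|apply ccont_mult]; now apply Hinv.
    + intros w Hw z Hz. destruct (Hfar w Hw z Hz) as [_ [N1 I1]].
      destruct (Hfar w0 W0 z Hz) as [_ [N2 I2]]. destruct (Hbd z Hz) as [_ [Hphi _]].
      replace (phi z * (/ (z - w) * / (z - w)) - phi z * (/ (z - w0) * / (z - w0)) -
         phi z * (2 * (/ (z - w0) * (/ (z - w0) * / (z - w0)))) * (w - w0))%C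
        with (phi z * (/ (z - w) * (/ (z - w0) * / (z - w0)) * (/ (z - w) + 2 * / (z - w0)))
              * ((w - w0) * (w - w0)))%C
        by (field; split; now apply Cminus_eq_contra).
      rewrite (Cmod_mult _ ((w - w0) * (w - w0))%C), (Cmod_mult (w - w0)).
      replace (Cmod (w - w0) ^ 2) with (Cmod (w - w0) * Cmod (w - w0)) by ring.
      apply Rmult_le_compat_r; [apply Rmult_le_pos; apply Cmod_ge_0|].
      rewrite (Cmod_mult (phi z)). apply Rmult_le_compat; auto using Cmod_ge_0.
      rewrite (Cmod_mult (/ (z - w) * (/ (z - w0) * / (z - w0)))%C).
      apply Rmult_le_compat; auto using Cmod_ge_0.
      * rewrite !Cmod_mult.
        repeat (apply Rmult_le_compat; repeat apply Rmult_le_pos; auto using Cmod_ge_0).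
      * eapply Rle_trans; [apply Cmod_triangle|]. rewrite Cmod_mult, Cmod_R, Rabs_right by lra. lra.
Qed.

Lemma cint_Re_ge (k : C) (f : R -> C) (a b m : R) : a <= b -> rcont_on f a b ->
  (forall t, a <= t <= b -> m <= Re (k * f t)%C) -> (b - a) * m <= Re (k * cint f a b)%C.
Proof.
  intros Hab Hf Hm. rewrite <- cint_scal by auto. simpl Re at 1.
  destruct (rcont_on_ex (fun t => k * f t)%C a b Hab) as [X _].
  { intros t Ht. apply rcont_scal. auto. }
  replace ((b - a) * m) with (RInt (fun _ => m) a b)
    by (rewrite (RInt_const (V := R_CompleteNormedModule)); reflexivity).
  apply RInt_le; auto.
  - apply (ex_RInt_const (V := R_NormedModule)).
  - intros t Ht. apply (Hm t). lra.
Qed.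

(* Each of the four sides contributes at least 1 to the imaginary part. *)
Lemma rect_inv_neq_0 (z0 : C) (s : R) : 0 < s ->
  rect (fun z => 1 * / (z - z0))%C (Re z0 - s) (Re z0 + s) (Im z0 - s) (Im z0 + s) <> RtoC 0.
Proof.
  intros Hs. set (p := Re z0). set (q := Im z0).
  assert (Hz : forall x y : R, ((x, y) - z0)%C = (x - p, y - q))
    by (intros; apply injective_projections; simpl; unfold p, q, Re, Im; ring).
  assert (HC : cont_bd (fun z => 1 * / (z - z0))%C (p - s) (p + s) (q - s) (q + s)).
  { apply cont_bd_on_bd; try lra. intros z [_ [_ H]].
    apply ccont_mult; [apply ccont_const|].
    apply (ccont_inv (fun z => z - z0)%C).
    - apply Cminus_eq_contra. intros ->. fold p q in H. lra.
    - apply (ccont_plus (fun z => z) (fun _ => - z0)%C); [apply ccont_id|apply ccont_const]. }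
  destruct (cont_bd_rcont _ _ _ _ _ HC) as [C1 [C2 [C3 C4]]].
  (* The rotated integrand on a side is [s / (t ^ 2 + s ^ 2)], smallest at the corners. Its minimum
     [1 / (2 * s)] times the side length [2 * s] is 1. *)
  assert (B : forall t, - s <= t <= s -> 1 / (2 * s) <= s / (t ^ 2 + s ^ 2)).
  { intros t Ht. assert (0 < t ^ 2 + s ^ 2) by nra.
    apply Rle_div_l; [lra|]. unfold Rdiv.
    replace (s * / (t ^ 2 + s ^ 2) * (2 * s)) with (2 * s ^ 2 / (t ^ 2 + s ^ 2)) by (field; lra).
    apply Rle_div_r; nra. }
  assert (Hre : forall (k : C) (x y : R), 0 < x ^ 2 + y ^ 2 ->
    Re (k * (1 * / ((x, y) : C)))%C = (Re k * x + Im k * y) / (x ^ 2 + y ^ 2)).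
  { intros k x y H. unfold Re, Im. simpl. field. simpl in H. lra. }
  assert (Hs2 : 0 < s ^ 2) by (apply pow_lt; lra).
  assert (Hpp : p - s <= p + s) by lra. assert (Hqq : q - s <= q + s) by lra.
  (* The factors [- Ci], [Ci], [- 1], [1] belong to the bottom, top, left and right side and make
     the real part of each integrand positive. *)
  assert (I1 := cint_Re_ge (- Ci)%C _ _ _ (1 / (2 * s)) Hpp C1).
  assert (I2 := cint_Re_ge Ci _ _ _ (1 / (2 * s)) Hpp C2).
  assert (I3 := cint_Re_ge (- (1))%C _ _ _ (1 / (2 * s)) Hqq C3).
  assert (I4 := cint_Re_ge 1%C _ _ _ (1 / (2 * s)) Hqq C4).
  lapply I1; clear I1; [intros I1|intros t Ht; rewrite Hz;
    assert (H2 := pow2_ge_0 (t - p));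
    rewrite Hre by (ring_simplify; ring_simplify in H2; lra);
    eapply Rle_trans; [apply (B (t - p)); lra|right; unfold Rdiv; f_equal; [simpl; ring|f_equal; ring]]].
  lapply I2; clear I2; [intros I2|intros t Ht; rewrite Hz;
    assert (H2 := pow2_ge_0 (t - p));
    rewrite Hre by (ring_simplify; ring_simplify in H2; lra);
    eapply Rle_trans; [apply (B (t - p)); lra|right; unfold Rdiv; f_equal; [simpl; ring|f_equal; ring]]].
  lapply I3; clear I3; [intros I3|intros t Ht; rewrite Hz;
    assert (H2 := pow2_ge_0 (t - q));
    rewrite Hre by (ring_simplify; ring_simplify in H2; lra);
    eapply Rle_trans; [apply (B (t - q)); lra|right; unfold Rdiv; f_equal; [simpl; ring|f_equal; ring]]].
  lapply I4; clear I4; [intros I4|intros t Ht; rewrite Hz;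
    assert (H2 := pow2_ge_0 (t - q));
    rewrite Hre by (ring_simplify; ring_simplify in H2; lra);
    eapply Rle_trans; [apply (B (t - q)); lra|right; unfold Rdiv; f_equal; [simpl; ring|f_equal; ring]]].
  replace ((p + s - (p - s)) * (1 / (2 * s))) with 1 in I1, I2 by (field; lra).
  replace ((q + s - (q - s)) * (1 / (2 * s))) with 1 in I3, I4 by (field; lra).
  intros E. apply (f_equal Im) in E. revert E I1 I2 I3 I4. unfold rect.
  set (X1 := cint _ _ _). set (X2 := cint _ _ _). set (X3 := cint _ _ _). set (X4 := cint _ _ _).
  unfold Re, Im. simpl. lra.
Qed.

(** Near [z0], [f] is the quotient of two Cauchy transforms, of [f] and of the constant 1. Each
    transform is twice differentiable because its kernel is, and the denominator is nonzero at the
    centre of the square, hence nearby. So [f'] agrees near [z0] with the quotient-rule expression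
    [G], which is differentiable at [z0]. *)
Lemma cdiff_derivative (f f' : C -> C) (z0 : C) (R0 : R) : 0 < R0 ->
  (forall z, Cmod (z - z0) < R0 -> cdiff f z (f' z)) -> exists l, cdiff f' z0 l.
Proof.
  (* The closed square of half-side [s] lies in the disc of radius [2 * s], half of [R0]. *)
  intros HR Hf. set (s := R0 / 4).
  assert (Hs : 0 < s) by (unfold s; lra).
  set (a := Re z0 - s). set (b := Re z0 + s). set (c := Im z0 - s). set (d := Im z0 + s).
  assert (Hin : forall x y, a <= x <= b -> c <= y <= d -> Cmod ((x, y) - z0) <= 2 * s).
  { intros x y Hx Hy. eapply Rle_trans; [apply Cmod_le_Re_Im|].
    assert (Rabs (Re ((x, y) - z0)%C) <= s)
      by (apply Rabs_le; unfold a, b, Re in *; simpl; lra).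
    assert (Rabs (Im ((x, y) - z0)%C) <= s)
      by (apply Rabs_le; unfold c, d, Im in *; simpl; lra).
    lra. }
  assert (Hf2 : forall x y, a <= x <= b -> c <= y <= d -> exists l, cdiff f (x, y) l).
  { intros x y Hx Hy. exists (f' (x, y)). apply Hf. specialize (Hin x y Hx Hy). unfold s in *; lra. }
  destruct (disc_bounded (fun z => Cmod (f z)) z0 (2 * s)) as [M HM]; [lra| |].
  { intros z Hz. assert (Cf := cdiff_ccont _ _ _ (Hf z ltac:(unfold s in *; lra))).
    destruct (Cf 1 Rlt_0_1) as [dl [Hdl H]]. exists dl, (Cmod (f z) + 1). split; auto.
    intros w _ Hw. specialize (H w Hw). generalize (Cmod_sub_le (f w) (f z)). lra. }
  assert (Hfar : forall z, on_bd a b c d z -> s <= Cmod (z - z0)).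
  { intros z [_ [_ H]].
    assert (H1 := re_le_Cmod (z - z0)). assert (H2 := Im_le_Cmod (z - z0)).
    assert (E1 : Re (z - z0)%C = Re z - Re z0) by apply Re_minus. rewrite E1 in H1.
    assert (E2 : Im (z - z0)%C = Im z - Im z0) by apply Im_minus. rewrite E2 in H2.
    apply Rabs_le_between in H1. apply Rabs_le_between in H2.
    unfold a, b, c, d in H. lra. }
  set (T := fun (phi : C -> C) w => rect (fun z => phi z * / (z - w))%C a b c d).
  set (T2 := fun (phi : C -> C) w => rect (fun z => phi z * (/ (z - w) * / (z - w)))%C a b c d).
  assert (HT : forall phi M', (forall z, on_bd a b c d z -> Cmod (phi z) <= M' /\ ccont phi z) ->
    forall w, Cmod (w - z0) < s / 2 -> cdiff (T phi) w (T2 phi w) /\ exists l, cdiff (T2 phi) w l).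
  { intros phi M' Hphi w Hw.
    apply (cauchy_kernel_cdiff phi a b c d (s / 4) M'); try (unfold a, b, c, d; lra).
    intros z Hz. split; auto. specialize (Hfar z Hz).
    generalize (Cmod_dist_triangle z w z0). lra. }
  assert (HTf := HT f M). lapply HTf; clear HTf; [intros HTf|].
  2:{ intros [x y] [Hx [Hy _]]. simpl in Hx, Hy. split; [apply HM, Hin; auto|].
      destruct (Hf2 x y Hx Hy) as [l Hl]. eapply cdiff_ccont, Hl. }
  assert (HT1 := HT (fun _ => RtoC 1) 1). lapply HT1; clear HT1; [intros HT1|].
  2:{ intros z _. rewrite Cmod_1. split; [lra|apply ccont_const]. }
  assert (Z0 : Cmod (z0 - z0) < s / 2) by (rewrite Cmod_sub_diag; lra).
  assert (N0 : T (fun _ => RtoC 1) z0 <> RtoC 0) by exact (rect_inv_neq_0 z0 s Hs).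
  destruct (cdiff_ccont _ _ _ (proj1 (HT1 z0 Z0)) (Cmod (T (fun _ => RtoC 1) z0))) as [dl [Hdl HN]].
  { now apply Cmod_gt_0. }
  set (r := Rmin dl (s / 2)).
  assert (Hr : 0 < r) by (apply Rmin_glb_lt; lra).
  assert (R1 : r <= dl) by apply Rmin_l. assert (R2 : r <= s / 2) by apply Rmin_r.
  assert (Hnz : forall w, Cmod (w - z0) < r -> T (fun _ => RtoC 1) w <> RtoC 0).
  { intros w Hw E. specialize (HN w ltac:(lra)). rewrite E in HN.
    rewrite Cmod_sym in HN. unfold Cminus in HN. rewrite Copp_0, Cplus_0_r in HN. lra. }
  assert (Hquot : forall w, Cmod (w - z0) < r -> f w = (T f w / T (fun _ => RtoC 1) w)%C).
  { intros w Hw. assert (E : T f w = (f w * T (fun _ => RtoC 1) w)%C).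
    { apply (cauchy_square f a b c d w); [| |exact Hf2].
      - assert (H := re_le_Cmod (w - z0)).
        assert (E1 : Re (w - z0)%C = Re w - Re z0) by apply Re_minus. rewrite E1 in H.
        apply Rabs_le_between in H. unfold a, b. lra.
      - assert (H := Im_le_Cmod (w - z0)).
        assert (E1 : Im (w - z0)%C = Im w - Im z0) by apply Im_minus. rewrite E1 in H.
        apply Rabs_le_between in H. unfold c, d. lra. }
    rewrite E. field. auto. }
  set (G := fun w => ((T2 f w * T (fun _ => RtoC 1) w - T f w * T2 (fun _ => RtoC 1) w)
                  / (T (fun _ => RtoC 1) w * T (fun _ => RtoC 1) w))%C).
  assert (HG : forall w, Cmod (w - z0) < r -> G w = f' w).
  { intros w Hw. apply (cdiff_unique f w).
    - apply (cdiff_ext_loc (fun w => T f w / T (fun _ => RtoC 1) w)%C _ _ _ (r - Cmod (w - z0))).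
      + lra.
      + intros v Hv. symmetry. apply Hquot. generalize (Cmod_dist_triangle v w z0). lra.
      + apply cdiff_div; auto; [apply HTf|apply HT1]; lra.
    - apply Hf. unfold s in *. lra. }
  destruct (proj2 (HTf z0 Z0)) as [l1 Hl1]. destruct (proj2 (HT1 z0 Z0)) as [l2 Hl2].
  destruct (HTf z0 Z0) as [Df _]. destruct (HT1 z0 Z0) as [D1 _].
  eexists. apply (cdiff_ext_loc G _ _ _ r); auto.
  apply (cdiff_div (fun w => T2 f w * T (fun _ => RtoC 1) w - T f w * T2 (fun _ => RtoC 1) w)%C
    (fun w => T (fun _ => RtoC 1) w * T (fun _ => RtoC 1) w)%C).
  - now apply Cmult_neq_0.
  - exact (cdiff_minus _ _ _ _ _ (cdiff_mult _ _ _ _ _ Hl1 D1) (cdiff_mult _ _ _ _ _ Df Hl2)).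
  - exact (cdiff_mult _ _ _ _ _ D1 D1).
Qed.

(** * The maximum principle and Schwarz's lemma *)

(** Along the segment, the derivative of the remainder is the first-order error of [f'], at most
    [eps * Cmod h]; the mean value bound supplies the second factor [Cmod h]. *)
Lemma taylor_2 (f f' : C -> C) (z0 f2 : C) (R0 : R) : 0 < R0 ->
  (forall z, Cmod (z - z0) < R0 -> cdiff f z (f' z)) -> cdiff f' z0 f2 ->
  forall eps, 0 < eps -> exists delta, 0 < delta /\ forall h, Cmod h < delta ->
    Cmod (f (z0 + h)%C - f z0 - f' z0 * h - f2 / 2 * (h * h)) <= eps * Cmod h ^ 2.
Proof.
  intros HR Hf Hf2 e He. destruct (Hf2 e He) as [d [Hd H]].
  exists (Rmin R0 d). split; [now apply Rmin_glb_lt|]. intros h Hh.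
  assert (h1 : Cmod h < R0) by (eapply Rlt_le_trans; [exact Hh|apply Rmin_l]).
  assert (h2 : Cmod h < d) by (eapply Rlt_le_trans; [exact Hh|apply Rmin_r]).
  assert (K := cdiff_segment_bound
    (fun w => f w - f' z0 * (w - z0) - f2 / 2 * ((w - z0) * (w - z0)))%C
    (fun w => f' w - f' z0 - f2 * (w - z0))%C z0 h (e * Cmod h)).
  lapply K; clear K; [intros K|].
  - replace (e * Cmod h ^ 2) with (e * Cmod h * Cmod h) by ring.
    eapply Rle_trans; [|exact K]. right. f_equal. field.
  - intros t Ht. set (w := (z0 + RtoC t * h)%C).
    assert (Hw : Cmod (w - z0) <= Cmod h).
    { replace (w - z0)%C with (RtoC t * h)%C by (unfold w; ring).
      rewrite Cmod_mult, Cmod_R, Rabs_right by lra. generalize (Cmod_ge_0 h). nra. }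
    split.
    + eapply cdiff_eq.
      * apply (cdiff_minus (fun w => f w - f' z0 * (w - z0))%C
          (fun w => f2 / 2 * ((w - z0) * (w - z0)))%C).
        -- apply (cdiff_minus f (fun w => f' z0 * (w - z0))%C); [apply Hf; lra|].
           apply (cdiff_scal (f' z0) (fun w => w - z0)%C).
           apply (cdiff_minus (fun w => w) (fun _ => z0)); [apply cdiff_id|apply cdiff_const].
        -- apply (cdiff_scal (f2 / 2) (fun w => (w - z0) * (w - z0))%C).
           apply (cdiff_mult (fun w => w - z0)%C (fun w => w - z0)%C);
           apply (cdiff_minus (fun w => w) (fun _ => z0)); (apply cdiff_id || apply cdiff_const).
      * field.
    + eapply Rle_trans; [apply H; lra|]. apply Rmult_le_compat_l; lra.
Qed.

(* The four directions s, -s, is, -is kill the linear and quadratic Taylor terms. *)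
Lemma four_point_mean (f f' : C -> C) (z0 : C) (R0 : R) : 0 < R0 ->
  (forall z, Cmod (z - z0) < R0 -> cdiff f z (f' z)) ->
  forall eps, 0 < eps -> exists delta, 0 < delta /\ forall s, 0 < s < delta ->
    4 * Cmod (f z0) <= Cmod (f (z0 + RtoC s)%C) + Cmod (f (z0 - RtoC s)%C)
      + Cmod (f (z0 + Ci * RtoC s)%C) + Cmod (f (z0 - Ci * RtoC s)%C) + 4 * eps * s ^ 2.
Proof.
  intros HR Hf e He. destruct (cdiff_derivative f f' z0 R0 HR Hf) as [f2 Hf2].
  destruct (taylor_2 f f' z0 f2 R0 HR Hf Hf2 e He) as [d [Hd H]].
  exists d. split; auto. intros s Hs.
  assert (S1 : Cmod (RtoC s) = s) by (rewrite Cmod_R; apply Rabs_right; lra).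
  assert (S2 : Cmod (- RtoC s) = s) by now rewrite Cmod_opp.
  assert (S3 : Cmod (Ci * RtoC s) = s) by (rewrite Cmod_mult, Cmod_Ci, S1; ring).
  assert (S4 : Cmod (- (Ci * RtoC s)) = s) by now rewrite Cmod_opp.
  assert (H1 := H (RtoC s)). assert (H2 := H (- RtoC s)%C).
  assert (H3 := H (Ci * RtoC s)%C). assert (H4 := H (- (Ci * RtoC s))%C).
  rewrite S1 in H1. rewrite S2 in H2. rewrite S3 in H3. rewrite S4 in H4.
  specialize (H1 (proj2 Hs)). specialize (H2 (proj2 Hs)).
  specialize (H3 (proj2 Hs)). specialize (H4 (proj2 Hs)).
  revert H1 H2 H3 H4.
  set (E1 := (_ - f2 / 2 * (RtoC s * RtoC s))%C).
  set (E2 := (_ - f2 / 2 * (- RtoC s * - RtoC s))%C).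
  set (E3 := (_ - f2 / 2 * (Ci * RtoC s * (Ci * RtoC s)))%C).
  set (E4 := (_ - f2 / 2 * (- (Ci * RtoC s) * - (Ci * RtoC s)))%C).
  intros H1 H2 H3 H4.
  assert (I2 : (Ci * Ci = - (1))%C) by (apply injective_projections; simpl; ring).
  assert (Sum : (RtoC 4 * f z0 = f (z0 + RtoC s) + f (z0 - RtoC s) + f (z0 + Ci * RtoC s)
    + f (z0 - Ci * RtoC s) - (E1 + E2 + E3 + E4))%C).
  { unfold E1, E2, E3, E4, Cminus at 1 2.
    replace (- (Ci * RtoC s) * - (Ci * RtoC s))%C with (Ci * Ci * (RtoC s * RtoC s))%C by ring.
    replace (Ci * RtoC s * (Ci * RtoC s))%C with (Ci * Ci * (RtoC s * RtoC s))%C by ring.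
    rewrite I2. unfold Cminus. field. }
  assert (E : 4 * Cmod (f z0) = Cmod (RtoC 4 * f z0)%C).
  { rewrite Cmod_mult, Cmod_R, Rabs_right by lra. ring. }
  rewrite E, Sum.
  eapply Rle_trans; [apply Cmod_triangle_sub|].
  generalize (Cmod_triangle (E1 + E2 + E3) E4) (Cmod_triangle (E1 + E2) E3) (Cmod_triangle E1 E2).
  generalize
   (Cmod_triangle (f (z0 + RtoC s) + f (z0 - RtoC s) + f (z0 + Ci * RtoC s))%C (f (z0 - Ci * RtoC s)%C))
   (Cmod_triangle (f (z0 + RtoC s) + f (z0 - RtoC s))%C (f (z0 + Ci * RtoC s)%C))
   (Cmod_triangle (f (z0 + RtoC s)%C) (f (z0 - RtoC s)%C)).
  lra.
Qed.

(* The term [eps * |z|^2] makes the four-point mean inequality strict, so that a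
   maximum of the perturbed modulus can only occur at 0 or on the circle. *)
Lemma max_principle_punctured (F : C -> C) (rho B : R) : 0 < rho ->
  (forall z, Cmod z <= rho -> ccont F z) ->
  (forall z, 0 < Cmod z < rho -> exists l, cdiff F z l) ->
  Cmod (F (RtoC 0)) <= B -> (forall z, Cmod z = rho -> Cmod (F z) <= B) ->
  forall z, Cmod z <= rho -> Cmod (F z) <= B.
Proof.
  intros Hrho HC HD H0 Hbd z Hz. apply Rnot_lt_le. intros Hlt.
  destruct (choose_derivative _ F HD) as [F' HF'].
  (* Makes [e * rho ^ 2] half of the excess over [B], so the perturbed maximum exceeds every
     perturbed value at 0 and on the circle. *)
  set (e := (Cmod (F z) - B) / (2 * rho ^ 2)).
  assert (Hr2 : 0 < rho ^ 2) by now apply pow_lt.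
  assert (He : 0 < e) by (apply Rdiv_lt_0_compat; lra).
  assert (He2 : e * rho ^ 2 = (Cmod (F z) - B) / 2) by (unfold e; field; lra).
  assert (Z0 : forall w, (w - 0)%C = w) by (intros; ring).
  destruct (disc_max (fun w => Cmod (F w) + e * Cmod w ^ 2) 0 rho) as [z1 [Hz1 Hmax]]; [lra| |].
  { intros w Hw eta Heta. rewrite Z0 in Hw.
    destruct (HC w Hw (eta / 2)) as [d1 [Hd1 H1]]; [lra|].
    set (d2 := eta / (2 * (e * (2 * rho + 1)))).
    assert (P : 0 < e * (2 * rho + 1)) by (apply Rmult_lt_0_compat; lra).
    assert (Hd2 : 0 < d2) by (apply Rdiv_lt_0_compat; lra).
    exists (Rmin d1 d2). split; [now apply Rmin_glb_lt|].
    intros v Hv Hvw. rewrite Z0 in Hv.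
    assert (K1 := H1 v (Rlt_le_trans _ _ _ Hvw (Rmin_l _ _))).
    assert (K2 := Rlt_le_trans _ _ _ Hvw (Rmin_r d1 d2)).
    assert (K3 : e * (2 * rho + 1) * Cmod (v - w) < eta / 2).
    { apply (Rmult_lt_compat_l _ _ _ P) in K2. eapply Rlt_le_trans; [exact K2|].
      right. unfold d2. field. lra. }
    assert (A1 : Rabs (Cmod (F v) - Cmod (F w)) < eta / 2).
    { apply Rabs_lt_between. generalize (Cmod_sub_le (F v) (F w)) (Cmod_sub_le (F w) (F v)).
      rewrite (Cmod_sym (F w)). lra. }
    assert (A2 : Rabs (Cmod v - Cmod w) <= Cmod (v - w)).
    { apply Rabs_le_between. generalize (Cmod_sub_le v w) (Cmod_sub_le w v).
      rewrite (Cmod_sym w). lra. }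
    replace (Cmod (F v) + e * Cmod v ^ 2 - (Cmod (F w) + e * Cmod w ^ 2))
      with ((Cmod (F v) - Cmod (F w)) + e * ((Cmod v + Cmod w) * (Cmod v - Cmod w))) by ring.
    eapply Rle_lt_trans; [apply Rabs_triang|].
    assert (A3 : Rabs (e * ((Cmod v + Cmod w) * (Cmod v - Cmod w)))
      <= e * (2 * rho + 1) * Cmod (v - w)).
    { assert (P1 := Cmod_ge_0 v). assert (P2 := Cmod_ge_0 w).
      rewrite !Rabs_mult, (Rabs_right e), (Rabs_right (Cmod v + Cmod w)) by lra.
      rewrite Rmult_assoc. apply Rmult_le_compat_l; [lra|].
      apply Rmult_le_compat; try lra. apply Rabs_pos. }
    lra. }
  rewrite Z0 in Hz1.
  assert (Hm := Hmax z). rewrite Z0 in Hm. specialize (Hm Hz). cbv beta in Hm.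
  assert (Hbig : B + e * rho ^ 2 < Cmod (F z1) + e * Cmod z1 ^ 2).
  { assert (0 <= e * Cmod z ^ 2) by (apply Rmult_le_pos; [lra|apply pow2_ge_0]). lra. }
  assert (N0 : z1 <> RtoC 0).
  { intros ->. rewrite Cmod_0 in Hbig. nra. }
  assert (N1 : Cmod z1 <> rho).
  { intros E. specialize (Hbd z1 E). rewrite E in Hbig. lra. }
  apply Cmod_gt_0 in N0.
  set (r := Rmin (Cmod z1) (rho - Cmod z1)).
  assert (Hr : 0 < r) by (apply Rmin_glb_lt; lra).
  assert (r1 : r <= Cmod z1) by apply Rmin_l. assert (r2 : r <= rho - Cmod z1) by apply Rmin_r.
  (* The squared moduli of the four neighbours sum to [4 * Cmod z1 ^ 2 + 4 * s ^ 2]. Maximality thus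
     costs [4 * e * s ^ 2], while the four-point error at [e / 2] returns only half of that. *)
  destruct (four_point_mean F F' z1 r Hr) with (eps := e / 2) as [d [Hd H4]]; [|lra|].
  { intros w Hw. apply HF'. generalize (Cmod_sub_le w z1) (Cmod_sub_le z1 w).
    rewrite (Cmod_sym z1). lra. }
  set (s := Rmin d r / 2).
  assert (s0 : 0 < Rmin d r) by now apply Rmin_glb_lt.
  assert (s1 := Rmin_l d r). assert (s2 := Rmin_r d r).
  assert (Hs : 0 < s < d) by (unfold s; lra).
  specialize (H4 s Hs).
  assert (S1 : Cmod (RtoC s) = s) by (rewrite Cmod_R; apply Rabs_right; lra).
  assert (S3 : Cmod (Ci * RtoC s) = s) by (rewrite Cmod_mult, Cmod_Ci, S1; ring).
  assert (Hin : forall h, Cmod h = s -> Cmod (z1 + h - 0) <= rho /\ Cmod (z1 - h - 0) <= rho).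
  { intros h Hh. rewrite !Z0. generalize (Cmod_triangle z1 h) (Cmod_triangle_sub z1 h).
    unfold s in *. lra. }
  assert (M1 := Hmax _ (proj1 (Hin _ S1))). assert (M2 := Hmax _ (proj2 (Hin _ S1))).
  assert (M3 := Hmax _ (proj1 (Hin _ S3))). assert (M4 := Hmax _ (proj2 (Hin _ S3))).
  rewrite !Cmod_sqr in M1, M2, M3, M4.
  assert (Sq : (Re (z1 + RtoC s)%C ^ 2 + Im (z1 + RtoC s)%C ^ 2)
    + (Re (z1 - RtoC s)%C ^ 2 + Im (z1 - RtoC s)%C ^ 2)
    + (Re (z1 + Ci * RtoC s)%C ^ 2 + Im (z1 + Ci * RtoC s)%C ^ 2)
    + (Re (z1 - Ci * RtoC s)%C ^ 2 + Im (z1 - Ci * RtoC s)%C ^ 2)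
    = 4 * (Re z1 ^ 2 + Im z1 ^ 2) + 4 * s ^ 2).
  { unfold Re, Im. simpl. ring. }
  apply (f_equal (Rmult e)) in Sq. rewrite !Rmult_plus_distr_l in *.
  assert (0 < e * s ^ 2) by (apply Rmult_lt_0_compat; auto; apply pow_lt; lra).
  lra.
Qed.

Lemma pow_unbounded (a q : R) : 0 < a -> 1 < q -> exists n, 1 < a * q ^ n.
Proof.
  intros Ha Hq. destruct (Pow_x_infinity q) with (b := / a + 1) as [N HN].
  { rewrite Rabs_right; lra. }
  exists N. specialize (HN N (le_n _)).
  rewrite Rabs_right in HN by (apply Rle_ge, pow_le; lra).
  apply Rge_le, (Rmult_le_compat_l a) in HN; [|lra].
  rewrite Rmult_plus_distr_l, Rinv_r in HN; lra.
Qed.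

(* The maximum principle is applied to F^(n+2) / z^(n+1), which vanishes at 0;
   then n tends to infinity. *)
Lemma schwarz_punctured (F : C -> C) (K delta : R) : 0 < delta ->
  (forall z, 0 < Cmod z < 1 -> exists l, cdiff F z l) ->
  (forall z, Cmod z < 1 -> Cmod (F z) <= 1) ->
  (forall z, Cmod z < delta -> Cmod (F z) <= K * Cmod z) ->
  forall z, Cmod z < 1 -> Cmod (F z) <= Cmod z.
Proof.
  intros Hdl HD H1 HK z Hz.
  assert (F0 : F (RtoC 0) = RtoC 0).
  { apply Cmod_eq_0, Rle_antisym; [|apply Cmod_ge_0].
    specialize (HK (RtoC 0)). rewrite Cmod_0, Rmult_0_r in HK. auto. }
  destruct (Ceq_dec z 0) as [->|n]; [rewrite F0; lra|].
  apply Cmod_gt_0 in n. apply Rnot_lt_le. intros Hlt.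
  set (a := Cmod (F z)) in *. set (r := Cmod z) in *.
  assert (Ha : a <= 1) by now apply H1.
  (* Halfway between [r / a] and 1, so [rho < 1] while [a * rho / r > 1]; the powers of the latter
     are unbounded. *)
  set (rho := (1 + r / a) / 2).
  assert (Hra : r / a < 1) by (apply Rlt_div_l; lra).
  assert (Hra2 : r <= r / a).
  { apply Rle_div_r; [lra|]. nra. }
  assert (Hrho : r / a < rho < 1) by (unfold rho; lra).
  assert (Hq : 1 < a * rho / r).
  { apply Rlt_div_r; [lra|]. assert (L : r < rho * a) by (apply Rlt_div_l; lra). lra. }
  destruct (pow_unbounded a _ ltac:(lra) Hq) as [m Hm].
  assert (Hm' : 1 < a * (a * rho / r) ^ S m).
  { simpl. assert (0 < (a * rho / r) ^ m) by (apply pow_lt; lra). nra. }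
  (* The surplus power of [F] makes [G] of order [Cmod w] at 0, hence continuous there with value 0.
     On the circle of radius [rho] its modulus is at most [1 / rho ^ S m]. *)
  set (G := fun w => (F w ^ S (S m) * / w ^ S m)%C).
  assert (G0 : G (RtoC 0) = RtoC 0) by (unfold G; rewrite F0, Cpow_S; ring).
  assert (GD : forall w, 0 < Cmod w < 1 -> exists l, cdiff G w l).
  { intros w Hw. destruct (HD w Hw) as [l Hl].
    assert (W0 : w <> RtoC 0) by now apply Cmod_gt_0.
    destruct (cdiff_pow F (S (S m)) w l Hl) as [l1 Hl1].
    destruct (cdiff_pow (fun w => w) (S m) w 1 (cdiff_id w)) as [l2 Hl2].
    eexists. apply (cdiff_mult (fun w => F w ^ S (S m))%C (fun w => / w ^ S m)%C); [exact Hl1|].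
    apply (cdiff_inv (fun w => w ^ S m)%C); [now apply Cpow_nz|exact Hl2]. }
  assert (GM : forall w, w <> RtoC 0 -> Cmod (G w) = Cmod (F w) ^ S (S m) / Cmod w ^ S m).
  { intros w Hw. unfold G. rewrite Cmod_mult, Cmod_inv by now apply Cpow_nz.
    now rewrite !Cmod_pow. }
  assert (KG : Cmod (G z) <= 1 / rho ^ S m).
  { apply (max_principle_punctured G rho); try lra.
    - intros w Hw. destruct (Ceq_dec w 0) as [->|W0].
      2:{ destruct (GD w) as [l Hl]; [split; [now apply Cmod_gt_0|lra]|]. eapply cdiff_ccont, Hl. }
      intros e He. set (K' := Rmax K 0).
      assert (HK' : 0 <= K' /\ K <= K') by (unfold K'; split; [apply Rmax_r|apply Rmax_l]).
      assert (P : 0 <= K' ^ S (S m)) by (apply pow_le; lra).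
      exists (Rmin delta (e / (K' ^ S (S m) + 1))). split.
      { apply Rmin_glb_lt; auto. apply Rdiv_lt_0_compat; lra. }
      intros w Hw2. rewrite G0.
      assert (Ew : (w - 0)%C = w) by ring. rewrite Ew in Hw2.
      replace (G w - 0)%C with (G w) by ring.
      destruct (Ceq_dec w 0) as [->|W0]; [rewrite G0, Cmod_0; lra|].
      assert (L1 := Rlt_le_trans _ _ _ Hw2 (Rmin_l _ _)).
      assert (L2 := Rlt_le_trans _ _ _ Hw2 (Rmin_r _ _)).
      rewrite GM by auto. apply Cmod_gt_0 in W0.
      assert (L3 : Cmod (F w) ^ S (S m) <= K' ^ S (S m) * Cmod w ^ S (S m)).
      { rewrite <- Rpow_mult_distr. apply pow_incr. split; [apply Cmod_ge_0|].
        specialize (HK w L1). nra. }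
      assert (Q : 0 < Cmod w ^ S m) by now apply pow_lt.
      apply Rlt_div_l; auto. eapply Rle_lt_trans; [exact L3|].
      replace (Cmod w ^ S (S m)) with (Cmod w * Cmod w ^ S m) by reflexivity.
      rewrite <- Rmult_assoc. apply Rmult_lt_compat_r; auto.
      assert (Cmod w * (K' ^ S (S m) + 1) < e).
      { apply Rlt_div_r; lra. }
      lra.
    - intros w Hw. apply GD. lra.
    - rewrite G0, Cmod_0. left. apply Rdiv_lt_0_compat; [lra|]. apply pow_lt.
      assert (0 < r / a) by (apply Rdiv_lt_0_compat; lra). lra.
    - intros w Hw. rewrite GM, Hw.
      + apply Rmult_le_compat_r.
        { left. apply Rinv_0_lt_compat, pow_lt.
          assert (0 < r / a) by (apply Rdiv_lt_0_compat; lra). lra. }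
        rewrite <- (pow1 (S (S m))). apply pow_incr. split; [apply Cmod_ge_0|].
        apply H1. lra.
      + apply Cmod_gt_0. assert (0 < r / a) by (apply Rdiv_lt_0_compat; lra). lra.
    - fold r. lra. }
  rewrite GM in KG by now apply Cmod_gt_0. fold a r in KG.
  assert (P1 : 0 < rho ^ S m) by (apply pow_lt; lra).
  assert (P2 : 0 < r ^ S m) by (apply pow_lt; lra).
  apply Rle_div_r in KG; auto.
  assert (a ^ S (S m) / r ^ S m * rho ^ S m = a * (a * rho / r) ^ S m).
  { unfold Rdiv. rewrite !Rpow_mult_distr, pow_inv. simpl. ring. }
  lra.
Qed.

(** * Starlike functions *)

(** Extending [u] by 0 off the circle keeps it locally bounded, since each interior point has a
    neighbourhood missing the circle. *)
Lemma circle_bounded (u : C -> R) (c : C) (rho : R) : 0 <= rho ->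
  (forall z, Cmod (z - c) = rho -> exists delta B, 0 < delta /\
     forall w, Cmod (w - c) = rho -> Cmod (w - z) < delta -> u w <= B) ->
  exists B, forall w, Cmod (w - c) = rho -> u w <= B.
Proof.
  intros Hr Hloc.
  destruct (disc_bounded (fun w => if Req_EM_T (Cmod (w - c)) rho then u w else 0) c rho Hr)
    as [B HB].
  - intros z Hz. destruct (Req_EM_T (Cmod (z - c)) rho) as [E|n].
    + destruct (Hloc z E) as [d [B [Hd H]]]. exists d, (Rmax B 0). split; auto.
      intros w _ Hw. destruct (Req_EM_T (Cmod (w - c)) rho) as [E'|_].
      * eapply Rle_trans; [apply H; auto|apply Rmax_l].
      * apply Rmax_r.
    + exists (rho - Cmod (z - c)), 0. split; [lra|]. intros w _ Hw.
      destruct (Req_EM_T (Cmod (w - c)) rho) as [E'|_]; [|lra].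
      generalize (Cmod_dist_triangle w z c). lra.
  - exists B. intros w E. specialize (HB w). cbv beta in HB.
    destruct (Req_EM_T (Cmod (w - c)) rho) as [_|n]; [|contradiction]. apply HB. lra.
Qed.

(* A minimum of |f - w| inside the disc must be a zero, since f' does not vanish. *)
Lemma open_mapping (f f' : C -> C) (z0 : C) (R0 eps : R) : 0 < eps < R0 ->
  (forall z, Cmod (z - z0) < R0 -> cdiff f z (f' z) /\ f' z <> RtoC 0) ->
  (forall z, Cmod (z - z0) < R0 -> f z = f z0 -> z = z0) ->
  exists delta, 0 < delta /\
    forall w, Cmod (w - f z0) < delta -> exists z, Cmod (z - z0) < eps /\ f z = w.
Proof.
  intros He Hf Hinj.
  assert (HC : forall z, Cmod (z - z0) < R0 -> ccont f z).
  { intros z Hz. eapply cdiff_ccont, Hf, Hz. }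
  assert (Hpos : forall z, Cmod (z - z0) = eps -> 0 < Cmod (f z - f z0)).
  { intros z Hz. apply Cmod_sub_pos. intros E. apply Hinj in E; [|lra]. subst z.
    rewrite Cmod_sub_diag in Hz. lra. }
  destruct (circle_bounded (fun z => / Cmod (f z - f z0)) z0 eps) as [B HB]; [lra| |].
  { intros z Hz. assert (P := Hpos z Hz).
    destruct (HC z ltac:(lra) (Cmod (f z - f z0) / 2)) as [d [Hd H]]; [lra|].
    exists d, (/ (Cmod (f z - f z0) / 2)). split; auto. intros w _ Hw. specialize (H w Hw).
    apply Rinv_le_contravar; [lra|].
    generalize (Cmod_dist_triangle (f z) (f w) (f z0)). rewrite (Cmod_sym (f z) (f w)). lra. }
  set (m := / (Rmax B 1)).
  assert (HB1 : 0 < Rmax B 1) by (generalize (Rmax_r B 1); lra).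
  assert (Hm : 0 < m) by now apply Rinv_0_lt_compat.
  assert (Hfar : forall z, Cmod (z - z0) = eps -> m <= Cmod (f z - f z0)).
  { intros z Hz. rewrite <- (Rinv_inv (Cmod (f z - f z0))). apply Rinv_le_contravar.
    - apply Rinv_0_lt_compat. auto.
    - eapply Rle_trans; [apply HB; auto|apply Rmax_l]. }
  exists (m / 2). split; [lra|]. intros w Hw.
  (* A minimum of the distance to [w]. It lies inside: at the centre the distance is below [m / 2],
     on the circle above it. *)
  destruct (disc_max (fun z => - Cmod (f z - w)) z0 eps) as [z1 [Hz1 Hmin]]; [lra| |].
  { intros z Hz e He'. destruct (HC z ltac:(lra) e He') as [d [Hd H]].
    exists d. split; auto. intros v _ Hv. specialize (H v Hv).
    apply Rabs_lt_between.
    generalize (Cmod_dist_triangle (f v) (f z) w) (Cmod_dist_triangle (f z) (f v) w).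
    rewrite (Cmod_sym (f z) (f v)). lra. }
  assert (Hz0 := Hmin z0). rewrite Cmod_sub_diag in Hz0. specialize (Hz0 ltac:(lra)).
  rewrite (Cmod_sym (f z0) w) in Hz0.
  assert (Hz1' : Cmod (z1 - z0) < eps).
  { destruct Hz1 as [H|H]; auto. specialize (Hfar z1 H).
    generalize (Cmod_dist_triangle (f z1) w (f z0)). lra. }
  exists z1. split; auto. apply NNPP. intros Hne.
  apply Cmod_sub_pos in Hne.
  destruct (Hf z1 ltac:(lra)) as [D1 N1].
  (* [e] is the Newton step: moving by [t * e] multiplies [c] by [1 - t], up to an error
     [eta * t * Cmod e]. The choice of [eta] keeps this error below half of the gain
     [t * Cmod c]. *)
  set (c := (f z1 - w)%C) in *. set (e := (- (c / f' z1))%C).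
  set (eta := Cmod c / (2 * (Cmod e + 1))).
  assert (Pe := Cmod_ge_0 e).
  assert (Heta : 0 < eta) by (apply Rdiv_lt_0_compat; lra).
  destruct (D1 eta Heta) as [d [Hd H]].
  set (t := Rmin 1 (Rmin d (eps - Cmod (z1 - z0)) / (Cmod e + 1)) / 2).
  assert (Q : 0 < Rmin d (eps - Cmod (z1 - z0))) by (apply Rmin_glb_lt; lra).
  assert (Q2 : 0 < Rmin d (eps - Cmod (z1 - z0)) / (Cmod e + 1)) by (apply Rdiv_lt_0_compat; lra).
  assert (Ht : 0 < t < 1).
  { unfold t. generalize (Rmin_l 1 (Rmin d (eps - Cmod (z1 - z0)) / (Cmod e + 1))).
    assert (0 < Rmin 1 (Rmin d (eps - Cmod (z1 - z0)) / (Cmod e + 1)))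
      by (apply Rmin_glb_lt; lra). lra. }
  assert (Hte : t * (Cmod e + 1) < Rmin d (eps - Cmod (z1 - z0))).
  { apply Rlt_div_r; [lra|]. unfold t.
    generalize (Rmin_r 1 (Rmin d (eps - Cmod (z1 - z0)) / (Cmod e + 1))). lra. }
  assert (L1 := Rmin_l d (eps - Cmod (z1 - z0))). assert (L2 := Rmin_r d (eps - Cmod (z1 - z0))).
  assert (Mte : Cmod (RtoC t * e) = t * Cmod e).
  { rewrite Cmod_mult, Cmod_R, Rabs_right by lra. auto. }
  specialize (H (z1 + RtoC t * e)%C).
  replace (z1 + RtoC t * e - z1)%C with (RtoC t * e)%C in H by ring.
  rewrite Mte in H. specialize (H ltac:(lra)).
  assert (Hcl : Cmod (z1 + RtoC t * e - z0) <= eps).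
  { replace (z1 + RtoC t * e - z0)%C with ((z1 - z0) + RtoC t * e)%C by ring.
    eapply Rle_trans; [apply Cmod_triangle|]. rewrite Mte. lra. }
  specialize (Hmin _ Hcl). fold c in Hmin.
  assert (K : Cmod (f (z1 + RtoC t * e)%C - w) <= (1 - t) * Cmod c + eta * (t * Cmod e)).
  { replace (f (z1 + RtoC t * e)%C - w)%C with
      (RtoC (1 - t) * c + (f (z1 + RtoC t * e) - f z1 - f' z1 * (RtoC t * e)))%C.
    - eapply Rle_trans; [apply Cmod_triangle|].
      rewrite Cmod_mult, Cmod_R, Rabs_right by lra. lra.
    - unfold e, c. rewrite RtoC_minus. field. auto. }
  assert (eta * (Cmod e + 1) = Cmod c / 2) by (unfold eta; field; lra).
  nra.
Qed.

(** The open mapping lemma writes each value near [h z0] as [h z] with [z] near [z0]. There [h]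
    expands distances by at least half of [Cmod (h' z0)], which turns the error of [h] into one for
    [k]. *)
Lemma cdiff_inverse (h h' k : C -> C) (z0 : C) :
  (forall z, unit_disc z -> cdiff h z (h' z) /\ h' z <> RtoC 0) ->
  one_to_one_on_disc h -> (forall z, unit_disc z -> k (h z) = z) ->
  unit_disc z0 -> cdiff k (h z0) (/ h' z0).
Proof.
  intros Hh Hinj Hk Hz0 e He. unfold unit_disc in *.
  destruct (Hh z0 Hz0) as [D0 N0]. assert (P := N0). apply Cmod_gt_0 in P.
  set (a := Cmod (h' z0)) in *.
  (* The first entry yields the expansion by [a / 2], the second the final error [e]. *)
  set (eta := Rmin (a / 2) (e * a ^ 2 / 2)).
  assert (E1 : eta <= a / 2) by apply Rmin_l. assert (E2 : eta <= e * a ^ 2 / 2) by apply Rmin_r.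
  assert (Pa : 0 < a ^ 2) by now apply pow_lt.
  assert (Heta : 0 < eta) by (apply Rmin_glb_lt; nra).
  destruct (D0 eta Heta) as [d [Hd H]].
  assert (Hball : forall z, Cmod (z - z0) < 1 - Cmod z0 -> Cmod z < 1).
  { intros z Hz. generalize (Cmod_sub_le z z0). lra. }
  destruct (open_mapping h h' z0 (1 - Cmod z0) (Rmin d (1 - Cmod z0) / 2)) as [dl [Hdl Hop]].
  - assert (0 < Rmin d (1 - Cmod z0)) by (apply Rmin_glb_lt; lra).
    generalize (Rmin_r d (1 - Cmod z0)). lra.
  - intros z Hz. apply Hh. auto.
  - intros z Hz E. apply Hinj; auto. apply Hball; auto.
  - exists dl. split; auto. intros w Hw. destruct (Hop w Hw) as [z [Hz Ez]].
    assert (0 < Rmin d (1 - Cmod z0)) by (apply Rmin_glb_lt; lra).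
    assert (L1 := Rmin_l d (1 - Cmod z0)). assert (L2 := Rmin_r d (1 - Cmod z0)).
    rewrite <- Ez. rewrite !Hk by (auto; apply Hball; lra).
    specialize (H z ltac:(lra)).
    replace (z - z0 - / h' z0 * (h z - h z0))%C
      with (- ((h z - h z0 - h' z0 * (z - z0)) / h' z0))%C by (field; auto).
    rewrite Cmod_opp, Cmod_div by auto. fold a.
    apply Rle_div_l; auto.
    assert (G : a / 2 * Cmod (z - z0) <= Cmod (h z - h z0)).
    { assert (K := Cmod_sub_le (h' z0 * (z - z0)) (- (h z - h z0 - h' z0 * (z - z0)))).
      rewrite Cmod_opp, Cmod_mult in K. fold a in K.
      replace (h' z0 * (z - z0) - - (h z - h z0 - h' z0 * (z - z0)))%C
        with (h z - h z0)%C in K by ring.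
      assert (Q := Cmod_ge_0 (z - z0)). nra. }
    assert (Q := Cmod_ge_0 (z - z0)).
    apply Rle_trans with (1 := H).
    apply Rle_trans with (e * a * (a / 2 * Cmod (z - z0))); [nra|].
    replace (e * Cmod (h z - h z0) * a) with (e * a * Cmod (h z - h z0)) by ring.
    apply Rmult_le_compat_l; auto. nra.
Qed.

Lemma disc_left_inverse (h : C -> C) : one_to_one_on_disc h ->
  exists k, forall z, unit_disc z -> k (h z) = z.
Proof.
  intros Hinj.
  exists (fun w => epsilon (inhabits (RtoC 0)) (fun z => unit_disc z /\ h z = w)).
  intros z Hz.
  destruct (epsilon_spec (inhabits (RtoC 0)) (fun v => unit_disc v /\ h v = h z)) as [H1 H2].
  - now exists z.
  - now apply Hinj.
Qed.

(** Supplies the growth hypothesis of [schwarz_punctured] when [F] is differentiable at 0. *)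
Lemma cdiff_linear_bound (F : C -> C) (l : C) : cdiff F 0 l -> F (RtoC 0) = RtoC 0 ->
  exists K delta, 0 < delta /\ forall z, Cmod z < delta -> Cmod (F z) <= K * Cmod z.
Proof.
  intros HF F0. destruct (HF 1 Rlt_0_1) as [d [Hd H]].
  exists (1 + Cmod l), d. split; auto. intros z Hz. specialize (H z).
  rewrite F0 in H. replace (z - 0)%C with z in H by ring. specialize (H Hz).
  replace (F z) with ((F z - 0 - l * z) + l * z)%C by ring.
  eapply Rle_trans; [apply Cmod_triangle|]. rewrite Cmod_mult. lra.
Qed.

Lemma unit_disc_0 : unit_disc 0.
Proof. unfold unit_disc. rewrite Cmod_0. lra. Qed.

(** An explicit nonvanishing derivative is bundled in, so that [h / h'] and the derivative of the
    inverse make sense; in the theorem it comes from the Jacobian. *)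
Definition starlike_map (h h' : C -> C) : Prop :=
  (forall z, unit_disc z -> cdiff h z (h' z) /\ h' z <> RtoC 0) /\
  one_to_one_on_disc h /\ h (RtoC 0) = RtoC 0 /\ starlike_wrt_0 (image_of_disc h).

(* Schwarz's lemma for the self-map z |-> h^-1 (t h(z)) of the disc. *)
Lemma starlike_contraction (h h' k : C -> C) (t : R) (z : C) :
  starlike_map h h' -> (forall z, unit_disc z -> k (h z) = z) ->
  0 <= t <= 1 -> unit_disc z ->
  h (k (RtoC t * h z)%C) = (RtoC t * h z)%C /\ Cmod (k (RtoC t * h z)%C) <= Cmod z.
Proof.
  intros [Hh [Hinj [H0 Hst]]] Hk Ht Hz.
  assert (Hpre : forall z, unit_disc z ->
    exists v, unit_disc v /\ h v = (RtoC t * h z)%C /\ k (RtoC t * h z)%C = v).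
  { intros u Hu. destruct (Hst (h u) t) as [v [Hv E]]; auto.
    - now exists u.
    - exists v. repeat split; auto. rewrite <- E. auto. }
  split.
  - destruct (Hpre z Hz) as [v [_ [E ->]]]. exact E.
  - assert (HD : forall u, unit_disc u -> exists l, cdiff (fun u => k (RtoC t * h u)%C) u l).
    { intros u Hu. destruct (Hpre u Hu) as [v [Hv [E _]]].
      eexists. apply (cdiff_comp k (fun u => RtoC t * h u)%C).
      - apply cdiff_scal. apply Hh, Hu.
      - rewrite <- E. apply (cdiff_inverse h h' k v Hh Hinj Hk Hv). }
    destruct (HD _ unit_disc_0) as [l Hl].
    destruct (cdiff_linear_bound _ _ Hl) as [K [d [Hd HK]]].
    { generalize (Hk _ unit_disc_0). now rewrite H0, Cmult_0_r. }
    apply (schwarz_punctured (fun u => k (RtoC t * h u)%C) K d); auto.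
    + intros u Hu. apply HD. apply Hu.
    + intros u Hu. destruct (Hpre u Hu) as [v [Hv [_ ->]]]. left. exact Hv.
Qed.

(** At a right endpoint only the difference quotients from the left are controlled, and these are
    nonnegative. *)
Lemma derive_ge_0_at_max (phi : R -> R) (l : R) :
  is_derive phi 1 l -> (forall t, 0 <= t <= 1 -> phi t <= phi 1) -> 0 <= l.
Proof.
  intros H Hmax. apply Rnot_lt_le. intros Hl.
  apply is_derive_Reals in H. destruct (H (- l / 2)) as [d Hd]; [lra|].
  set (s := Rmin (d / 2) (1 / 2)).
  assert (Pd := cond_pos d).
  assert (Hs : 0 < s) by (apply Rmin_glb_lt; lra).
  assert (S1 : s <= d / 2) by apply Rmin_l. assert (S2 : s <= 1 / 2) by apply Rmin_r.
  specialize (Hd (- s) ltac:(lra)). rewrite Rabs_Ropp, Rabs_right in Hd by lra.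
  specialize (Hd ltac:(lra)). apply Rabs_lt_between in Hd.
  specialize (Hmax (1 + - s) ltac:(lra)).
  assert (0 <= (phi (1 + - s) - phi 1) / - s).
  { replace ((phi (1 + - s) - phi 1) / - s) with ((phi 1 - phi (1 + - s)) / s) by (field; lra).
    apply Rmult_le_pos; [lra|]. left. now apply Rinv_0_lt_compat. }
  lra.
Qed.

(** The function t |-> Re(conj z * k(t h(z))) is at most |z|^2 on [0,1] and reaches this at t = 1,
    where its derivative is the quantity in question. Multiplying by conj z instead of dividing by z
    covers [z = 0]. *)
Lemma starlike_Re_ge_0 (h h' : C -> C) (z : C) : starlike_map h h' -> unit_disc z ->
  0 <= Re (Cconj z * (h z / h' z))%C.
Proof.
  intros Hs Hz. destruct Hs as [Hh [Hinj Hrest]] eqn:E. clear E.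
  destruct (disc_left_inverse h Hinj) as [k Hk].
  apply (derive_ge_0_at_max (fun t => Re (Cconj z * k (0 + RtoC t * h z)%C)%C)).
  - replace (Cconj z * (h z / h' z))%C with (Cconj z * / h' z * h z)%C
      by (field; apply Hh, Hz).
    apply (cdiff_is_derive_line (fun w => Cconj z * k w)%C). apply cdiff_scal.
    rewrite Cplus_0_l, Cmult_1_l. now apply (cdiff_inverse h h').
  - intros t Ht. destruct (starlike_contraction h h' k t z Hs Hk Ht Hz) as [_ K].
    rewrite !Cplus_0_l, Cmult_1_l, Hk by auto.
    eapply Rle_trans; [apply Re_le_Cmod|]. rewrite Cmod_mult, Cmod_conj.
    rewrite (Cmult_comm (Cconj z)), <- Cmod2_conj, re_RtoC.
    generalize (Cmod_ge_0 z). nra.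
Qed.

Lemma Cmod_minus_sqr (a b : C) :
  Cmod (a - b) ^ 2 = Cmod a ^ 2 + Cmod b ^ 2 - 2 * Re (Cconj a * b)%C.
Proof. rewrite !Cmod_sqr. unfold Re, Im. simpl. ring. Qed.

Lemma Cmod_plus_sqr (a b : C) :
  Cmod (a + b) ^ 2 = Cmod a ^ 2 + Cmod b ^ 2 + 2 * Re (Cconj a * b)%C.
Proof. rewrite !Cmod_sqr. unfold Re, Im. simpl. ring. Qed.

Lemma Cmod_le_of_sqr (a b : C) : Cmod a ^ 2 <= Cmod b ^ 2 -> Cmod a <= Cmod b.
Proof.
  intros H. apply Rsqr_incr_0_var; [|apply Cmod_ge_0]. rewrite !Rsqr_pow2. exact H.
Qed.

(* With q = h/h', the function (z - q)/(z + q) is the Cayley transform of q/z. *)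
Lemma starlike_cayley (h h' : C -> C) (z : C) : starlike_map h h' -> unit_disc z ->
  Cmod (z - h z / h' z) <= Cmod z * Cmod (z + h z / h' z).
Proof.
  intros Hs. assert (HRe := fun z => starlike_Re_ge_0 h h' z Hs).
  destruct Hs as [Hh [Hinj [H0 _]]]. revert z.
  set (q := fun z => (h z / h' z)%C).
  assert (Hh' : forall u, unit_disc u -> exists l, cdiff h' u l).
  { intros u Hu. apply (cdiff_derivative h h' u (1 - Cmod u)); [unfold unit_disc in Hu; lra|].
    intros v Hv. apply Hh. unfold unit_disc. generalize (Cmod_sub_le v u). lra. }
  assert (Hq : forall u, unit_disc u -> exists l, cdiff q u l).
  { intros u Hu. destruct (Hh' u Hu) as [l Hl]. eexists.
    apply (cdiff_div h h'); [apply Hh, Hu|apply Hh, Hu|exact Hl]. }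
  destruct (choose_derivative _ q Hq) as [q' Hq'].
  assert (q0 : q (RtoC 0) = RtoC 0).
  { unfold q. rewrite H0. field. apply Hh, unit_disc_0. }
  assert (q'0 : q' (RtoC 0) = RtoC 1).
  { destruct (Hh' _ unit_disc_0) as [l Hl]. apply (cdiff_unique q (RtoC 0)).
    - apply Hq', unit_disc_0.
    - eapply cdiff_eq.
      + apply (cdiff_div h h'); [apply Hh, unit_disc_0|apply Hh, unit_disc_0|exact Hl].
      + rewrite H0. field. apply Hh, unit_disc_0. }
  assert (Z0 : forall w, (w - 0)%C = w) by (intros; ring).
  assert (Hq'' : forall u, Cmod (u - 0) < 1 -> cdiff q u (q' u)).
  { intros u Hu. rewrite Z0 in Hu. now apply Hq'. }
  destruct (cdiff_derivative q q' 0 1 Rlt_0_1 Hq'') as [q2 Hq2].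
  destruct (taylor_2 q q' 0 q2 1 Rlt_0_1 Hq'' Hq2 1 Rlt_0_1) as [d [Hd HT]].
  set (B := Cmod (q2 / 2) + 1).
  assert (PB : 0 < B) by (generalize (Cmod_ge_0 (q2 / 2)); unfold B; lra).
  (* Since q(0) = 0 and q'(0) = 1, [u - q u] is of second order while [u + q u] behaves like
     [2 * u]; their quotient is then of first order, as [schwarz_punctured] requires. *)
  assert (HB : forall u, Cmod u < d -> Cmod (u - q u) <= B * Cmod u ^ 2).
  { intros u Hu. specialize (HT u Hu). rewrite q0, q'0, Cplus_0_l in HT.
    replace (u - q u)%C with (- (q u - 0 - 1 * u - q2 / 2 * (u * u)) - q2 / 2 * (u * u))%C
      by ring.
    eapply Rle_trans; [apply Cmod_triangle_sub|]. rewrite Cmod_opp, !Cmod_mult. unfold B.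
    simpl. simpl in HT. lra. }
  assert (Hnz : forall u, unit_disc u -> u <> RtoC 0 -> 0 < Cmod (u + q u)).
  { intros u Hu Hu0. apply Cmod_gt_0 in Hu0. apply Cmod_gt_0. intros E.
    specialize (HRe u Hu). fold (q u) in HRe.
    assert (K := Cmod_plus_sqr u (q u)). rewrite E, Cmod_0 in K.
    assert (0 < Cmod u ^ 2) by now apply pow_lt.
    generalize (pow2_ge_0 (Cmod (q u))). lra. }
  set (F := fun u => ((u - q u) / (u + q u))%C).
  assert (HF : forall u, unit_disc u -> Cmod (F u) <= Cmod u).
  { assert (F0 : F (RtoC 0) = RtoC 0) by (unfold F, Cdiv; rewrite q0; ring).
    (* The bound [/ B] gives [B * Cmod u <= 1], whence [Cmod (u + q u)] is at least
       [2 * Cmod u - B * Cmod u ^ 2], so at least [Cmod u]. *)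
    set (dl := Rmin (Rmin d 1) (/ B)).
    assert (D1 : dl <= d) by (eapply Rle_trans; [apply Rmin_l|apply Rmin_l]).
    assert (D2 : dl <= 1) by (eapply Rle_trans; [apply Rmin_l|apply Rmin_r]).
    assert (D3 : dl <= / B) by apply Rmin_r.
    assert (PiB : 0 < / B) by now apply Rinv_0_lt_compat.
    apply (schwarz_punctured F B dl).
    - repeat apply Rmin_glb_lt; lra.
    - intros u Hu. assert (Hd' : unit_disc u) by apply Hu. eexists.
      apply (cdiff_div (fun u => u - q u)%C (fun u => u + q u)%C).
      + apply Cmod_gt_0, Hnz; auto. now apply Cmod_gt_0.
      + apply (cdiff_minus (fun u => u) q); [apply cdiff_id|now apply Hq'].
      + apply (cdiff_plus (fun u => u) q); [apply cdiff_id|now apply Hq'].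
    - intros u Hu. destruct (Ceq_dec u 0) as [->|n]; [rewrite F0, Cmod_0; lra|].
      assert (P := Hnz u Hu n). unfold F. rewrite Cmod_div by now apply Cmod_gt_0.
      apply Rle_div_l; auto. rewrite Rmult_1_l. apply Cmod_le_of_sqr.
      rewrite Cmod_minus_sqr, Cmod_plus_sqr. specialize (HRe u Hu). fold (q u) in HRe. lra.
    - intros u Hu. destruct (Ceq_dec u 0) as [->|n].
      { rewrite F0, Cmod_0. lra. }
      assert (Hu1 : unit_disc u) by (unfold unit_disc; lra).
      assert (P := Hnz u Hu1 n). unfold F. rewrite Cmod_div by now apply Cmod_gt_0.
      apply Rle_div_l; auto. specialize (HB u ltac:(lra)).
      apply Cmod_gt_0 in n.
      assert (L : Cmod u <= Cmod (u + q u)).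
      { assert (K := Cmod_sub_le (2 * u) (u - q u)).
        replace (2 * u - (u - q u))%C with (u + q u)%C in K by ring.
        rewrite Cmod_mult, Cmod_R, Rabs_right in K by lra.
        assert (B * Cmod u <= 1).
        { rewrite <- (Rinv_r B) by lra. apply Rmult_le_compat_l; lra. }
        simpl in HB. nra. }
      eapply Rle_trans; [exact HB|].
      replace (B * Cmod u ^ 2) with (B * Cmod u * Cmod u) by ring.
      apply Rmult_le_compat_l; nra. }
  intros z Hz. destruct (Ceq_dec z 0) as [->|n].
  - fold (q (RtoC 0)). rewrite q0, Z0, Cmod_0. lra.
  - fold (q z). assert (P := Hnz z Hz n). specialize (HF z Hz). unfold F in HF.
    rewrite Cmod_div in HF by now apply Cmod_gt_0.
    apply Rle_div_l in HF; auto.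
Qed.

(** These are |z h'/h| <= (1+r)/(1-r) and (1-r)/(1+r) <= Re(z h'/h) <= (1+r)/(1-r), multiplied out
    so that [z = 0] is included. The real part governs the growth of |h| along a radius. *)
Lemma starlike_radial (h h' : C -> C) (z : C) : starlike_map h h' -> unit_disc z ->
  Cmod z * Cmod (h' z) * (1 - Cmod z) <= Cmod (h z) * (1 + Cmod z) /\
  Cmod (h z) ^ 2 * (1 - Cmod z) <= Re (Cconj (h z) * (h' z * z))%C * (1 + Cmod z) /\
  Re (Cconj (h z) * (h' z * z))%C * (1 - Cmod z) <= Cmod (h z) ^ 2 * (1 + Cmod z).
Proof.
  intros Hs Hz. assert (K := starlike_cayley h h' z Hs Hz).
  destruct Hs as [Hh _]. destruct (Hh z Hz) as [_ N].
  set (q := (h z / h' z)%C) in *.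
  assert (Eh : h z = (h' z * q)%C) by (unfold q; field; auto).
  rewrite Eh. clearbody q.
  assert (EX : Re (Cconj (h' z * q) * (h' z * z))%C = Cmod (h' z) ^ 2 * Re (Cconj z * q)%C).
  { rewrite Cmod_sqr. unfold Re, Im. simpl. ring. }
  rewrite EX, Cmod_mult.
  assert (K2 : Cmod (z - q) ^ 2 <= Cmod z ^ 2 * Cmod (z + q) ^ 2).
  { rewrite <- Rpow_mult_distr. apply pow_incr. split; [apply Cmod_ge_0|exact K]. }
  rewrite Cmod_minus_sqr, Cmod_plus_sqr in K2.
  assert (X1 : Re (Cconj z * q)%C <= Cmod z * Cmod q).
  { eapply Rle_trans; [apply Re_le_Cmod|]. rewrite Cmod_mult, Cmod_conj. lra. }
  assert (T1 := Cmod_sub_le z q). assert (T2 := Cmod_sub_le q z). rewrite (Cmod_sym q) in T2.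
  assert (T3 := Cmod_triangle z q).
  assert (Px := Cmod_ge_0 z). assert (Py := Cmod_ge_0 q). assert (Pd := Cmod_ge_0 (h' z)).
  unfold unit_disc in Hz.
  set (x := Cmod z) in *. set (y := Cmod q) in *. set (X := Re (Cconj z * q)%C) in *.
  set (D := Cmod (h' z)) in *. clearbody x y X D.
  assert (A1 : x * (1 - x) <= y * (1 + x)) by nra.
  assert (A2 : y * (1 - x) <= x * (1 + x)) by nra.
  assert (B1 : y ^ 2 * (1 - x) ^ 2 <= x ^ 2 * (1 + x) ^ 2).
  { rewrite <- !Rpow_mult_distr. apply pow_incr. nra. }
  assert (B2 : (x ^ 2 + y ^ 2) * (1 - x) * (1 + x) <= 2 * X * (1 + x ^ 2)) by lra.
  (* Split [2 * (1 + x ^ 2)] as [(1 - x) ^ 2 + (1 + x) ^ 2], use [B1] on the first square, then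
     [B2]. *)
  assert (A3 : y ^ 2 * (1 - x) <= X * (1 + x)).
  { apply (Rmult_le_reg_r (2 * (1 + x ^ 2))); [nra|].
    apply Rle_trans with ((1 + x) * ((x ^ 2 + y ^ 2) * (1 - x) * (1 + x))); [|nra].
    replace (y ^ 2 * (1 - x) * (2 * (1 + x ^ 2)))
      with ((1 - x) * (y ^ 2 * (1 - x) ^ 2 + y ^ 2 * (1 + x) ^ 2)) by ring.
    replace ((1 + x) * ((x ^ 2 + y ^ 2) * (1 - x) * (1 + x)))
      with ((1 - x) * (x ^ 2 * (1 + x) ^ 2 + y ^ 2 * (1 + x) ^ 2)) by ring.
    apply Rmult_le_compat_l; lra. }
  assert (A4 : X * (1 - x) <= y ^ 2 * (1 + x)) by nra.
  repeat split.
  - nra.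
  - rewrite Rpow_mult_distr, !Rmult_assoc. apply Rmult_le_compat_l; [apply pow2_ge_0|lra].
  - rewrite Rpow_mult_distr, !Rmult_assoc. apply Rmult_le_compat_l; [apply pow2_ge_0|lra].
Qed.

(** * Growth and distortion of starlike functions *)

Lemma is_derive_Cmod_sqr_line (h h' : C -> C) (z : C) (t : R) :
  cdiff h (RtoC t * z) (h' (RtoC t * z)%C) ->
  is_derive (fun s => Cmod (h (RtoC s * z)%C) ^ 2) t
    (2 * Re (Cconj (h (RtoC t * z)%C) * (h' (RtoC t * z)%C * z))%C).
Proof.
  intros H. rewrite <- (Cplus_0_l (RtoC t * z)) in H.
  assert (D1 := cdiff_is_derive_line h 0 z _ t H).
  (* The imaginary part of [h] is the real part of [- Ci * h]. *)
  assert (D2 := cdiff_is_derive_line (fun w => - Ci * h w)%C 0 z _ t (cdiff_scal (- Ci)%C h _ _ H)).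
  rewrite Cplus_0_l in D1, D2.
  apply (is_derive_ext (fun s => Re (h (0 + RtoC s * z)%C) ^ 2 + Re (- Ci * h (0 + RtoC s * z)%C)%C ^ 2)).
  { intros s. rewrite Cplus_0_l, Cmod_sqr. unfold Re, Im. simpl. ring. }
  assert (E1 := is_derive_pow _ 2 _ _ D1). assert (E2 := is_derive_pow _ 2 _ _ D2).
  assert (E := is_derive_plus (V := R_NormedModule) _ _ _ _ _ E1 E2).
  match goal with |- is_derive _ _ ?l => match type of E with is_derive _ _ ?l' =>
    replace l with l' end end; [exact E|].
  rewrite Cplus_0_l. unfold plus, Re, Im. simpl. ring.
Qed.

(** Stands in for the limit t -> 0 in the growth estimate: by monotonicity, one point where |h(tz)|
    is close to t |z| is enough. *)
Lemma derivative_one_near_0 (h : C -> C) (z : C) (e : R) :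
  cdiff h 0 1 -> h (RtoC 0) = RtoC 0 -> 0 < e ->
  exists t, 0 < t < 1 /\
    (1 - e) * (t * Cmod z) <= Cmod (h (RtoC t * z)%C) <= (1 + e) * (t * Cmod z).
Proof.
  intros H H0 He. destruct (H e He) as [d [Hd K]].
  assert (P := Cmod_ge_0 z).
  set (t := Rmin (1 / 2) (d / (2 * (Cmod z + 1)))).
  assert (Q : 0 < d / (2 * (Cmod z + 1))) by (apply Rdiv_lt_0_compat; lra).
  assert (T1 : t <= 1 / 2) by apply Rmin_l.
  assert (T2 : t <= d / (2 * (Cmod z + 1))) by apply Rmin_r.
  assert (T0 : 0 < t) by (apply Rmin_glb_lt; lra).
  apply Rle_div_r in T2; [|lra].
  assert (M : Cmod (RtoC t * z) = t * Cmod z) by (rewrite Cmod_mult, Cmod_R, Rabs_right; lra).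
  exists t. split; [lra|].
  specialize (K (RtoC t * z)%C).
  replace (RtoC t * z - 0)%C with (RtoC t * z)%C in K by ring.
  rewrite M in K. specialize (K ltac:(nra)).
  replace (h (RtoC t * z) - h (RtoC 0) - 1 * (RtoC t * z))%C
    with (h (RtoC t * z) - RtoC t * z)%C in K by (rewrite H0; ring).
  assert (K1 := Cmod_sub_le (h (RtoC t * z)%C) (RtoC t * z)).
  assert (K2 := Cmod_sub_le (RtoC t * z) (h (RtoC t * z)%C)).
  rewrite (Cmod_sym (RtoC t * z)) in K2. rewrite M in K1, K2. lra.
Qed.

(* |h(tz)|^2 (1+tr)^4 / t^2 is nondecreasing in t and |h(tz)|^2 (1-tr)^4 / t^2 is
   nonincreasing; both tend to r^2 as t tends to 0. *)
Lemma starlike_growth (h h' : C -> C) (z : C) : starlike_map h h' -> h' (RtoC 0) = RtoC 1 ->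
  unit_disc z ->
  Cmod z <= Cmod (h z) * (1 + Cmod z) ^ 2 /\ Cmod (h z) * (1 - Cmod z) ^ 2 <= Cmod z.
Proof.
  intros Hs H1 Hz. assert (HR := fun w => starlike_radial h h' w Hs).
  destruct Hs as [Hh [_ [H0 _]]].
  destruct (Ceq_dec z 0) as [->|n].
  { rewrite H0, Cmod_0. split; lra. }
  apply Cmod_gt_0 in n. unfold unit_disc in Hz.
  assert (D0 : cdiff h 0 1) by (rewrite <- H1; apply Hh, unit_disc_0).
  set (r := Cmod z) in *.
  assert (Mt : forall t, 0 <= t -> Cmod (RtoC t * z) = t * r).
  { intros t Ht. rewrite Cmod_mult, Cmod_R, Rabs_right by lra. auto. }
  set (m := fun t => Cmod (h (RtoC t * z)%C) ^ 2).
  set (N := fun t => Re (Cconj (h (RtoC t * z)%C) * (h' (RtoC t * z)%C * z))%C).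
  assert (Dm : forall t, 0 < t <= 1 -> is_derive m t (2 * N t)).
  { intros t Ht. apply is_derive_Cmod_sqr_line. apply Hh. unfold unit_disc. rewrite Mt by lra. nra. }
  assert (HN : forall t, 0 < t <= 1 ->
    m t * (1 - t * r) <= t * N t * (1 + t * r) /\ t * N t * (1 - t * r) <= m t * (1 + t * r)).
  { intros t Ht. assert (Hd : unit_disc (RtoC t * z)) by (unfold unit_disc; rewrite Mt by lra; nra).
    destruct (HR _ Hd) as [_ K]. rewrite Mt in K by lra.
    replace (t * N t) with (Re (Cconj (h (RtoC t * z)%C) * (h' (RtoC t * z)%C * (RtoC t * z)))%C).
    - exact K.
    - unfold N, Re. simpl. ring. }
  assert (P4 : forall t u v, 0 < t -> 0 <= u -> 0 <= v -> 0 <= u ^ 3 / t ^ 3 * v).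
  { intros t u v Ht Hu Hv. apply Rmult_le_pos; auto. apply Rmult_le_pos; [now apply pow_le|].
    left. apply Rinv_0_lt_compat. now apply pow_lt. }
  assert (Inc : forall t, 0 < t < 1 ->
    m t * ((1 + t * r) ^ 4 / t ^ 2) <= m 1 * ((1 + 1 * r) ^ 4 / 1 ^ 2)).
  { intros t0 Ht0.
    (* Since [4 * (t * r) - 2 * (1 + t * r)] is [- 2 * (1 - t * r)], the last factor is twice the
       slack in the first inequality of [HN]. *)
    apply (incr_of_derive (fun t => m t * ((1 + t * r) ^ 4 / t ^ 2))
      (fun t => (1 + t * r) ^ 3 / t ^ 3 *
        (2 * (t * N t * (1 + t * r)) + m t * (4 * (t * r) - 2 * (1 + t * r))))); [lra|].
    intros t Ht. split.
    - assert (Dg : is_derive (fun t => (1 + t * r) ^ 4 / t ^ 2) t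
        (4 * r * (1 + t * r) ^ 3 / t ^ 2 - 2 * (1 + t * r) ^ 4 / t ^ 3)).
      { auto_derive; [nra|]. field. lra. }
      assert (E := is_derive_mult (K := R_AbsRing) _ _ t _ _ (Dm t ltac:(lra)) Dg Rmult_comm).
      match goal with |- is_derive _ _ ?l => match type of E with is_derive _ _ ?l' =>
        replace l with l' end end; [exact E|].
      unfold plus, mult. simpl. field. lra.
    - destruct (HN t ltac:(lra)) as [K _]. apply P4; [lra|nra|lra]. }
  assert (Dec : forall t, 0 < t < 1 ->
    m 1 * ((1 - 1 * r) ^ 4 / 1 ^ 2) <= m t * ((1 - t * r) ^ 4 / t ^ 2)).
  { intros t0 Ht0. apply Ropp_le_cancel.
    apply (incr_of_derive (fun t => - (m t * ((1 - t * r) ^ 4 / t ^ 2)))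
      (fun t => (1 - t * r) ^ 3 / t ^ 3 *
        (m t * (4 * (t * r) + 2 * (1 - t * r)) - 2 * (t * N t * (1 - t * r))))); [lra|].
    intros t Ht. split.
    - assert (Dg : is_derive (fun t => (1 - t * r) ^ 4 / t ^ 2) t
        (- 4 * r * (1 - t * r) ^ 3 / t ^ 2 - 2 * (1 - t * r) ^ 4 / t ^ 3)).
      { auto_derive; [nra|]. field. lra. }
      assert (E := is_derive_opp (V := R_NormedModule) _ _ _
        (is_derive_mult (K := R_AbsRing) _ _ t _ _ (Dm t ltac:(lra)) Dg Rmult_comm)).
      match goal with |- is_derive _ _ ?l => match type of E with is_derive _ _ ?l' =>
        replace l with l' end end; [exact E|].
      unfold opp, plus, mult. simpl. field. lra.
    - destruct (HN t ltac:(lra)) as [_ K]. apply P4; [lra|nra|lra]. }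
  assert (m1 : m 1 = Cmod (h z) ^ 2) by (unfold m; now rewrite Cmult_1_l).
  assert (Hp := Cmod_ge_0 (h z)).
  assert (Sq : forall u v, 0 <= v -> u ^ 2 <= v ^ 2 -> u <= v).
  { intros u v Hv H. destruct (Rle_dec u v); auto. nra. }
  split.
  - apply Rnot_lt_le. intros Hlt. set (A := Cmod (h z) * (1 + r) ^ 2) in *.
    (* Puts [(1 - e) * r] midway between [A] and [r], above [A]. *)
    set (e := (r - A) / (2 * r)).
    assert (He : 0 < e) by (apply Rdiv_lt_0_compat; lra).
    assert (Er : e * r = (r - A) / 2) by (unfold e; field; lra).
    assert (HA : 0 <= A) by (unfold A; apply Rmult_le_pos; auto; apply pow2_ge_0).
    destruct (derivative_one_near_0 h z e D0 H0 He) as [t [Ht [L _]]]. fold r in L.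
    specialize (Inc t Ht). rewrite m1 in Inc.
    assert ((1 - e) * r <= A).
    { apply Sq; auto.
      apply Rle_trans with (m t * ((1 + t * r) ^ 4 / t ^ 2)); [|eapply Rle_trans; [exact Inc|]].
      - apply Rle_trans with (m t / t ^ 2).
        + assert (P2 : 0 < t ^ 2) by (apply pow_lt; lra).
          apply (proj1 (Rle_div_r _ _ _ P2)). rewrite <- Rpow_mult_distr.
          unfold m. apply pow_incr. assert (0 <= (1 - e) * r) by lra. split; nra.
        + unfold Rdiv. apply Rmult_le_compat_l; [apply pow2_ge_0|].
          rewrite <- (Rmult_1_l (/ t ^ 2)) at 1. apply Rmult_le_compat_r.
          * left. apply Rinv_0_lt_compat, pow_lt; lra.
          * apply pow_R1_Rle. nra.
      - right. unfold A. field. }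
    lra.
  - apply Rnot_lt_le. intros Hlt. set (A := Cmod (h z) * (1 - r) ^ 2) in *.
    set (e := (A - r) / (2 * r)).
    assert (He : 0 < e) by (apply Rdiv_lt_0_compat; lra).
    assert (Er : e * r = (A - r) / 2) by (unfold e; field; lra).
    destruct (derivative_one_near_0 h z e D0 H0 He) as [t [Ht [_ L]]]. fold r in L.
    specialize (Dec t Ht). rewrite m1 in Dec.
    assert (A <= (1 + e) * r).
    { apply Sq; [nra|].
      apply Rle_trans with (m t * ((1 - t * r) ^ 4 / t ^ 2)); [eapply Rle_trans; [|exact Dec]|].
      - right. unfold A. field.
      - apply Rle_trans with (m t / t ^ 2).
        + unfold Rdiv. apply Rmult_le_compat_l; [apply pow2_ge_0|].
          rewrite <- (Rmult_1_l (/ t ^ 2)) at 2. apply Rmult_le_compat_r.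
          * left. apply Rinv_0_lt_compat, pow_lt; lra.
          * rewrite <- (pow1 4). apply pow_incr. nra.
        + assert (P2 : 0 < t ^ 2) by (apply pow_lt; lra).
          apply (proj2 (Rle_div_l _ _ _ P2)). rewrite <- Rpow_mult_distr.
          unfold m. apply pow_incr. split; [apply Cmod_ge_0|nra]. }
    lra.
Qed.

Lemma starlike_distortion (h h' : C -> C) (z : C) : starlike_map h h' ->
  h' (RtoC 0) = RtoC 1 -> unit_disc z ->
  Cmod (h' z) <= (1 + Cmod z) / (1 - Cmod z) ^ 3.
Proof.
  intros Hs H1 Hz. destruct (starlike_growth h h' z Hs H1 Hz) as [_ G].
  destruct (starlike_radial h h' z Hs Hz) as [K _]. unfold unit_disc in Hz.
  destruct (Ceq_dec z 0) as [->|n].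
  { rewrite H1, Cmod_0, Cmod_1. lra. }
  apply Cmod_gt_0 in n. apply Rle_div_r; [apply pow_lt; lra|].
  apply (Rmult_le_reg_l (Cmod z)); auto.
  set (r := Cmod z) in *. assert (0 < (1 - r) ^ 2) by (apply pow_lt; lra).
  apply Rle_trans with (Cmod (h z) * (1 + r) * (1 - r) ^ 2).
  - replace (r * (Cmod (h' z) * (1 - r) ^ 3))
      with (r * Cmod (h' z) * (1 - r) * (1 - r) ^ 2) by ring.
    apply Rmult_le_compat_r; lra.
  - replace (Cmod (h z) * (1 + r) * (1 - r) ^ 2)
      with (Cmod (h z) * (1 - r) ^ 2 * (1 + r)) by ring.
    apply Rmult_le_compat_r; lra.
Qed.

(** * The dilatation and the bound for the co-analytic part *)

Lemma schwarz_pick_0 (phi : C -> C) (z : C) :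
  (forall w, unit_disc w -> exists l, cdiff phi w l) ->
  (forall w, unit_disc w -> Cmod (phi w) < 1) -> unit_disc z ->
  Cmod (phi z) <= (Cmod (phi (RtoC 0)) + Cmod z) / (1 + Cmod (phi (RtoC 0)) * Cmod z).
Proof.
  intros HD H1 Hz. set (b := phi (RtoC 0)).
  assert (Hb : Cmod b < 1) by apply H1, unit_disc_0. assert (Pb := Cmod_ge_0 b).
  set (den := fun w => (1 - Cconj b * phi w)%C).
  assert (Hden : forall w, unit_disc w -> 0 < Cmod (den w)).
  { intros w Hw. assert (K := Cmod_sub_le 1 (Cconj b * phi w)).
    rewrite Cmod_1, Cmod_mult, Cmod_conj in K. specialize (H1 w Hw).
    assert (P := Cmod_ge_0 (phi w)). unfold den. nra. }
  assert (E1 : forall w, Cmod (phi w - b) ^ 2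
    = Cmod (phi w) ^ 2 + Cmod b ^ 2 - 2 * Re (Cconj b * phi w)%C).
  { intros w. rewrite Cmod_sym, Cmod_minus_sqr. ring. }
  assert (E2 : forall w, Cmod (den w) ^ 2
    = 1 + Cmod b ^ 2 * Cmod (phi w) ^ 2 - 2 * Re (Cconj b * phi w)%C).
  { intros w. unfold den. rewrite Cmod_minus_sqr, Cmod_1, Cmod_mult, Cmod_conj.
    replace (Cconj 1 * (Cconj b * phi w))%C with (Cconj b * phi w)%C
      by (apply injective_projections; simpl; ring). ring. }
  (* The disc automorphism taking [b] to 0, applied to [phi]. It is bounded by 1 because the squared
     moduli of denominator and numerator differ by [(1 - Cmod b ^ 2) * (1 - Cmod (phi w) ^ 2)]. *)
  set (F := fun w => ((phi w - b) / den w)%C).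
  assert (FD : forall w, unit_disc w -> exists l, cdiff F w l).
  { intros w Hw. destruct (HD w Hw) as [l Hl]. eexists.
    apply (cdiff_div (fun w => phi w - b)%C den).
    - now apply Cmod_gt_0, Hden.
    - apply (cdiff_minus phi (fun _ => b)); [exact Hl|apply cdiff_const].
    - apply (cdiff_minus (fun _ => RtoC 1) (fun w => Cconj b * phi w)%C);
        [apply cdiff_const|apply cdiff_scal; exact Hl]. }
  assert (F0 : F (RtoC 0) = RtoC 0).
  { unfold F. fold b. unfold Cdiv, Cminus. rewrite Cplus_opp_r. apply Cmult_0_l. }
  destruct (FD _ unit_disc_0) as [l Hl].
  destruct (cdiff_linear_bound F l Hl F0) as [K [d [Hd HK]]].
  assert (HF : Cmod (F z) <= Cmod z).
  { apply (schwarz_punctured F K d); auto.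
    - intros w Hw. apply FD. apply Hw.
    - intros w Hw. unfold F. rewrite Cmod_div by now apply Cmod_gt_0, Hden.
      apply Rle_div_l; [now apply Hden|]. rewrite Rmult_1_l. apply Cmod_le_of_sqr.
      rewrite E1, E2. specialize (H1 w Hw). assert (P := Cmod_ge_0 (phi w)).
      assert (0 <= (1 - Cmod b ^ 2) * (1 - Cmod (phi w) ^ 2)) by (apply Rmult_le_pos; nra).
      lra. }
  unfold F in HF. rewrite Cmod_div in HF by now apply Cmod_gt_0, Hden.
  apply Rle_div_l in HF; [|now apply Hden].
  assert (HF2 : Cmod (phi z - b) ^ 2 <= Cmod z ^ 2 * Cmod (den z) ^ 2).
  { rewrite <- Rpow_mult_distr. apply pow_incr. split; [apply Cmod_ge_0|exact HF]. }
  rewrite E1, E2 in HF2.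
  assert (HX : Re (Cconj b * phi z)%C <= Cmod b * Cmod (phi z)).
  { eapply Rle_trans; [apply Re_le_Cmod|]. rewrite Cmod_mult, Cmod_conj. lra. }
  assert (Px := Cmod_ge_0 (phi z)). assert (Pr := Cmod_ge_0 z). specialize (H1 z Hz).
  unfold unit_disc in Hz.
  set (x := Cmod (phi z)) in *. set (a := Cmod b) in *. set (r := Cmod z) in *.
  apply Rle_div_r; [nra|].
  (* Replacing the real part by its largest value [a * x] turns [HF2] into an inequality between two
     squares. *)
  assert (Q0 : 0 <= (1 - r ^ 2) * (a * x - Re (Cconj b * phi z)%C))
    by (apply Rmult_le_pos; nra).
  assert (Q : (x - a) ^ 2 <= (r * (1 - a * x)) ^ 2) by lra.
  assert (0 <= r * (1 - a * x)) by (apply Rmult_le_pos; nra).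
  assert (x - a <= r * (1 - a * x)).
  { apply Rnot_lt_le. intros L. nra. }
  lra.
Qed.

Lemma dilatation_majorant_mono (a s r : R) : 0 <= a < 1 -> 0 <= s <= r ->
  (a + s) / (1 + a * s) <= (a + r) / (1 + a * r).
Proof.
  intros Ha Hs. apply Rle_div_l; [nra|].
  replace ((a + r) / (1 + a * r) * (1 + a * s)) with ((a + r) * (1 + a * s) / (1 + a * r))
    by (field; nra).
  apply Rle_div_r; [nra|].
  (* The difference of the two sides after cross-multiplication. *)
  assert (0 <= (r - s) * (1 - a * a)) by (apply Rmult_le_pos; nra). lra.
Qed.

(* g is integrated along the h-preimage of the segment [0, h(z)], which stays in
   the disc of radius |z|. *)
Lemma starlike_companion_bound (h h' g g' : C -> C) (a : R) (z : C) : starlike_map h h' ->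
  0 <= a < 1 -> (forall w, unit_disc w -> cdiff g w (g' w)) -> g (RtoC 0) = RtoC 0 ->
  (forall w, unit_disc w -> Cmod (g' w / h' w) <= (a + Cmod w) / (1 + a * Cmod w)) ->
  unit_disc z ->
  Cmod (g z) <= (a + Cmod z) / (1 + a * Cmod z) * Cmod (h z).
Proof.
  intros Hs Ha Hg g0 Hdil Hz. destruct Hs as [Hh [Hinj [H0 Hst]]] eqn:E. clear E.
  destruct (disc_left_inverse h Hinj) as [k Hk].
  (* In the coordinate [w = h u], the derivative of [g] is the dilatation g'/h' itself, which is why
     its bound carries over to |g| / |h|. *)
  assert (K := cdiff_segment_bound (fun w => g (k w)) (fun w => g' (k w) / h' (k w))%C 0 (h z)
    ((a + Cmod z) / (1 + a * Cmod z))).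
  lapply K; clear K; [intros K|].
  - rewrite Cplus_0_l, Hk in K by auto.
    replace (g (k (RtoC 0))) with (RtoC 0) in K.
    + now replace (g z - 0)%C with (g z) in K by ring.
    + generalize (Hk _ unit_disc_0). rewrite H0. now intros ->.
  - intros t Ht. rewrite Cplus_0_l.
    destruct (starlike_contraction h h' k t z Hs Hk Ht Hz) as [E L].
    assert (Hv : unit_disc (k (RtoC t * h z)%C)) by (unfold unit_disc in *; lra).
    split.
    + apply (cdiff_comp g k); [|now apply Hg].
      assert (D := cdiff_inverse h h' k _ Hh Hinj Hk Hv). rewrite E in D. exact D.
    + eapply Rle_trans; [apply Hdil, Hv|]. apply dilatation_majorant_mono; auto.
      split; [apply Cmod_ge_0|exact L].
Qed.

(** * The upper bound *)

(** The primitive vanishing at 0 of (1+x)/(1-x)^3 * (1 + (a+x)/(1+ax)), the distortion bound for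
    |h'| times one plus the dilatation bound. The second factor is (1+a)(1+x)/(1+ax); partial
    fractions yield the logarithm. *)
Definition upper_majorant (a x : R) : R :=
  ((1 - a) / (1 + a)) ^ 2 * ln ((1 + a * x) / (1 - x))
  + 2 * x / (1 - x) ^ 2 - (1 - a) / (1 + a) * (2 * x / (1 - x)).

Lemma upper_majorant_0 (a : R) : upper_majorant a 0 = 0.
Proof.
  unfold upper_majorant. replace ((1 + a * 0) / (1 - 0)) with 1 by field.
  rewrite ln_1. unfold Rdiv. ring.
Qed.

Lemma is_derive_upper_majorant (a x : R) : 0 <= a < 1 -> 0 <= x < 1 ->
  is_derive (upper_majorant a) x ((1 + x) / (1 - x) ^ 3 * (1 + (a + x) / (1 + a * x))).
Proof.
  intros Ha Hx. unfold upper_majorant. assert (0 <= a * x) by nra. auto_derive.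
  - repeat split; try lra; try nra. apply Rdiv_lt_0_compat; lra.
  - field. repeat split; lra.
Qed.

(** Both sides vanish at 0, and the derivative of their difference simplifies to (1-a)(1+a) t /
    ((1+at)^2 (1-t)^2), which is nonnegative. *)
Lemma upper_majorant_le (a x : R) : 0 <= a < 1 -> 0 <= x < 1 ->
  upper_majorant a x <= (1 + a) * x * (1 + x) / ((1 + a * x) * (1 - x) ^ 2).
Proof.
  intros Ha Hx.
  assert (K := incr_of_derive
    (fun t => (1 + a) * t * (1 + t) / ((1 + a * t) * (1 - t) ^ 2) - upper_majorant a t)
    (fun t => (1 - a) * (1 + a) * t / ((1 + a * t) ^ 2 * (1 - t) ^ 2)) 0 x (proj1 Hx)).
  lapply K; clear K; [intros K|].
  - rewrite upper_majorant_0 in K. unfold Rdiv in K at 1.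
    rewrite Rmult_0_r, !Rmult_0_l in K. lra.
  - intros t Ht. assert (0 <= a * t) by nra. split.
    + assert (D := is_derive_upper_majorant a t Ha ltac:(lra)).
      assert (D2 : is_derive (fun t => (1 + a) * t * (1 + t) / ((1 + a * t) * (1 - t) ^ 2)) t
        ((1 + t) / (1 - t) ^ 3 * (1 + (a + t) / (1 + a * t))
         + (1 - a) * (1 + a) * t / ((1 + a * t) ^ 2 * (1 - t) ^ 2))).
      { auto_derive; [|field; repeat split; lra].
        assert (0 < (1 + a * t) * (1 - t) ^ 2)
          by (apply Rmult_lt_0_compat; [lra|apply pow_lt; lra]).
        simpl in *; lra. }
      assert (E := is_derive_minus (V := R_NormedModule) _ _ _ _ _ D2 D).
      match goal with |- is_derive _ _ ?l => match type of E with is_derive _ _ ?l' =>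
        replace l with l' end end; [exact E|].
      unfold minus, plus, opp. simpl. ring.
    + apply Rmult_le_pos; [repeat apply Rmult_le_pos; lra|].
      left. apply Rinv_0_lt_compat. apply Rmult_lt_0_compat; apply pow_lt; lra.
Qed.

(** After rotating the value at [z] to a positive number, the conjugate is moved from [g] onto [v].
    What remains is a sum of real parts of analytic functions, whose radial derivative is at most
    [r * F']. *)
Lemma harmonic_radial_bound (h h' g g' : C -> C) (F F' : R -> R) (z : C) : unit_disc z ->
  (forall w, unit_disc w -> cdiff h w (h' w) /\ cdiff g w (g' w)) ->
  h (RtoC 0) = RtoC 0 -> g (RtoC 0) = RtoC 0 -> F 0 = 0 ->
  (forall x, 0 <= x < 1 -> is_derive F x (F' x)) ->
  (forall w, unit_disc w -> Cmod (h' w) + Cmod (g' w) <= F' (Cmod w)) ->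
  Cmod (h z + Cconj (g z)) <= F (Cmod z).
Proof.
  intros Hz Hd h0 g0 F0 HF Hle. unfold unit_disc in Hz.
  destruct (unit_rotation (h z + Cconj (g z))) as [v [Hv E]].
  apply (f_equal Re) in E. rewrite re_RtoC in E.
  set (r := Cmod z) in *. assert (Pr : 0 <= r) by apply Cmod_ge_0.
  assert (K := incr_of_derive
    (fun t => F (t * r) - (Re (v * h (0 + RtoC t * z)%C)%C + Re (Cconj v * g (0 + RtoC t * z)%C)%C))
    (fun t => r * F' (t * r) - (Re (v * h' (0 + RtoC t * z)%C * z)%C
                               + Re (Cconj v * g' (0 + RtoC t * z)%C * z)%C)) 0 1 Rle_0_1).
  lapply K; clear K; [intros K|].
  - rewrite !Cplus_0_l, Cmult_0_l, !Cmult_1_l, h0, g0, !Cmult_0_r, Rmult_0_l, Rmult_1_l, F0 in K.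
    rewrite !re_RtoC in K. rewrite <- E.
    replace (Re (v * (h z + Cconj (g z)))%C) with (Re (v * h z)%C + Re (Cconj v * g z)%C); [lra|].
    unfold Re. simpl. ring.
  - intros t Ht. assert (M : Cmod (0 + RtoC t * z) = t * r).
    { rewrite Cplus_0_l, Cmod_mult, Cmod_R, Rabs_right by lra. auto. }
    assert (Htr : 0 <= t * r < 1) by nra.
    assert (Hw : unit_disc (0 + RtoC t * z)) by (unfold unit_disc; lra).
    destruct (Hd _ Hw) as [Dh Dg]. split.
    + apply (is_derive_minus (V := R_NormedModule)).
      * apply (is_derive_comp F (fun t => t * r)); [now apply HF|].
        auto_derive; auto. ring.
      * apply (is_derive_plus (V := R_NormedModule)).
        -- apply (cdiff_is_derive_line (fun w => v * h w)%C). now apply cdiff_scal.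
        -- apply (cdiff_is_derive_line (fun w => Cconj v * g w)%C). now apply cdiff_scal.
    + specialize (Hle _ Hw). rewrite M in Hle.
      assert (A1 := Re_le_Cmod (v * h' (0 + RtoC t * z)%C * z)).
      assert (A2 := Re_le_Cmod (Cconj v * g' (0 + RtoC t * z)%C * z)).
      rewrite !Cmod_mult, Hv in A1. rewrite !Cmod_mult, Cmod_conj, Hv in A2.
      fold r in A1, A2. nra.
Qed.

Theorem theorem2p9 :
  forall (alpha : R) (f h g : C -> C),
    0 <= alpha < 1 ->
    L_H_starlike alpha f h g ->
    forall z : C, unit_disc z ->
      Cmod (f z) >=
        (1 - alpha) * Cmod z * (1 - Cmod z)
          / ((1 + alpha * Cmod z) * (1 + Cmod z) ^ 2) /\
      Cmod (f z) <=
        ((1 - alpha) / (1 + alpha)) ^ 2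
            * ln ((1 + alpha * Cmod z) / (1 - Cmod z))
          + 2 * Cmod z / (1 - Cmod z) ^ 2
          - (1 - alpha) / (1 + alpha) * (2 * Cmod z / (1 - Cmod z)) /\
      ((1 - alpha) / (1 + alpha)) ^ 2
            * ln ((1 + alpha * Cmod z) / (1 - Cmod z))
          + 2 * Cmod z / (1 - Cmod z) ^ 2
          - (1 - alpha) / (1 + alpha) * (2 * Cmod z / (1 - Cmod z)) <=
        (1 + alpha) * Cmod z * (1 + Cmod z)
          / ((1 + alpha * Cmod z) * (1 - Cmod z) ^ 2).
Proof.
  intros a f h g Ha [[[Ah [Ag [g0 Hf]]] [_ [HJ [h0 h'0]]]] [g'0 [_ [Hinj [_ Hst]]]]] z Hz.
  set (h' := C_derive h) in *. set (g' := C_derive g) in *.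
  assert (Dh : forall w, unit_disc w -> cdiff h w (h' w)).
  { intros w Hw. apply is_derive_cdiff, C_derive_correct; auto. }
  assert (Dg : forall w, unit_disc w -> cdiff g w (g' w)).
  { intros w Hw. apply is_derive_cdiff, C_derive_correct; auto. }
  (* Positivity of the Jacobian serves twice: [h'] has no zero, and the dilatation maps the disc
     into itself. *)
  assert (Hlt : forall w, unit_disc w -> Cmod (g' w) < Cmod (h' w)).
  { intros w Hw. specialize (HJ w Hw). unfold jacobian in HJ. fold h' g' in HJ.
    generalize (Cmod_ge_0 (g' w)) (Cmod_ge_0 (h' w)). nra. }
  assert (Nh : forall w, unit_disc w -> 0 < Cmod (h' w)).
  { intros w Hw. specialize (Hlt w Hw). generalize (Cmod_ge_0 (g' w)). lra. }
  assert (Hs : starlike_map h h').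
  { repeat split; auto. now apply Cmod_gt_0, Nh. }
  assert (Hderiv : forall u u' : C -> C, (forall w, unit_disc w -> cdiff u w (u' w)) ->
    forall w, unit_disc w -> exists l, cdiff u' w l).
  { intros u u' Hu w Hw. apply (cdiff_derivative u u' w (1 - Cmod w)); [unfold unit_disc in Hw; lra|].
    intros v Hv. apply Hu. unfold unit_disc. generalize (Cmod_sub_le v w). lra. }
  set (om := fun x => (a + x) / (1 + a * x)).
  assert (Hdil : forall w, unit_disc w -> Cmod (g' w / h' w) <= om (Cmod w)).
  { assert (E0 : Cmod (g' (RtoC 0) / h' (RtoC 0)) = a).
    { rewrite h'0, Cmod_div, Cmod_1, g'0 by apply C1_nz. field. }
    intros w Hw. unfold om. rewrite <- E0. apply (schwarz_pick_0 (fun w => g' w / h' w)%C); auto.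
    - intros u Hu. destruct (Hderiv g g' Dg u Hu) as [l1 H1].
      destruct (Hderiv h h' Dh u Hu) as [l2 H2]. eexists.
      apply (cdiff_div g' h'); [now apply Cmod_gt_0, Nh|exact H1|exact H2].
    - intros u Hu. rewrite Cmod_div by now apply Cmod_gt_0, Nh.
      apply Rlt_div_l; [now apply Nh|]. rewrite Rmult_1_l. auto. }
  assert (Hg' : forall w, unit_disc w -> Cmod (g' w) <= om (Cmod w) * Cmod (h' w)).
  { intros w Hw. specialize (Hdil w Hw). rewrite Cmod_div in Hdil by now apply Cmod_gt_0, Nh.
    exact (proj1 (Rle_div_l _ _ _ (Nh w Hw)) Hdil). }
  assert (Pr := Cmod_ge_0 z).
  split; [|split].
  - assert (G := starlike_companion_bound h h' g g' a z Hs Ha Dg g0 Hdil Hz).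
    destruct (starlike_growth h h' z Hs h'0 Hz) as [L _].
    unfold unit_disc in Hz. rewrite (Hf z Hz).
    assert (T := Cmod_sub_le (h z) (- Cconj (g z))).
    rewrite Cmod_opp, Cmod_conj in T.
    replace (h z - - Cconj (g z))%C with (h z + Cconj (g z))%C in T by ring.
    set (r := Cmod z) in *. assert (0 <= a * r) by (apply Rmult_le_pos; lra).
    assert (P2 : 0 < (1 + r) ^ 2) by (apply pow_lt; lra).
    (* The factor [1 - (a + r) / (1 + a * r)] equals [(1 - a) * (1 - r) / (1 + a * r)], nonnegative,
       so the lower growth bound for |h| may be inserted. *)
    apply Rle_ge. apply Rle_trans with ((1 - (a + r) / (1 + a * r)) * Cmod (h z)); [|lra].
    apply Rle_div_l in L; auto.
    replace ((1 - a) * r * (1 - r) / ((1 + a * r) * (1 + r) ^ 2))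
      with ((1 - (a + r) / (1 + a * r)) * (r / (1 + r) ^ 2)) by (field; lra).
    apply Rmult_le_compat_l; auto.
    replace (1 - (a + r) / (1 + a * r)) with ((1 - a) * (1 - r) / (1 + a * r)) by (field; lra).
    apply Rmult_le_pos; [apply Rmult_le_pos; lra|].
    left. apply Rinv_0_lt_compat. lra.
  - rewrite (Hf z Hz).
    apply (harmonic_radial_bound h h' g g' (upper_majorant a)
      (fun x => (1 + x) / (1 - x) ^ 3 * (1 + om x))); auto.
    + apply upper_majorant_0.
    + intros x Hx. now apply is_derive_upper_majorant.
    + intros w Hw. specialize (Hg' w Hw).
      assert (D := starlike_distortion h h' w Hs h'0 Hw).
      assert (0 <= om (Cmod w)).
      { unfold om. assert (P := Cmod_ge_0 w). apply Rmult_le_pos; [lra|].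
        left. apply Rinv_0_lt_compat. nra. }
      apply Rle_trans with (Cmod (h' w) * (1 + om (Cmod w))); [lra|].
      apply Rmult_le_compat_r; lra.
  - apply (upper_majorant_le a (Cmod z)); auto.
Qed.
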